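(* Let $D=\Lambda\times\{1,-1\}$ be the $\Lambda$-duplicate, with the topology having basis $\{W(r,t,i) : t\in\Lambda,\ i\in\{1,-1\},\ r\in\Lambda\cup\{0\},\ r\prec t\}$, and let $K$ be the 1-point compactification of $D$. Then $K$ is a scattered compact non-Gruenhage space having property $( * )$. Moreover, the Banach space $C(K)$ admits an equivalent lattice norm whose dual norm is strictly convex.
   Context: All topological spaces are Hausdorff. A space is scattered if every non-empty open subset (equivalently, every non-empty subset) has a relatively isolated point. The tree $\Lambda$: $\Lambda$ is the set of all injective functions $t:\alpha\to\omega$, where $\alpha$ is a countable ordinal and $\omega\setminus\operatorname{ran} t$ is infinite; $s\preccurlyeq t$ means that $t$ extends $s$. Write $\operatorname{dom} t$ for the domain of $t$ and $\operatorname{ran} t$ for its range. Let $0$ be an extra element not in $\Lambda$ (distinct from the empty function $\varnothing\in\Lambda$), with $0\prec t$ for all $t\in\Lambda$. For $t\in\Lambda$ and $r\in\Lambda\cup\{0\}$ let $(r,t]=\{s\in\Lambda : r\prec s\preccurlyeq t\}$. The sequences $\tau(s,t)$: for $s,t\in\Lambda$ with $s\prec t$, define ordinals $\operatorname{dom} t=\beta_0>\beta_1>\dots>\beta_k=\operatorname{dom} s$ as follows: given $\beta_i>\operatorname{dom} s$, let $\beta_{i+1}\in[\operatorname{dom} s,\beta_i)$ be the unique ordinal such that $t(\beta_{i+1})\le t(\xi)$ for all $\xi\in[\operatorname{dom} s,\beta_i)$; the process stops at a finite stage $k>0$ with $\beta_k=\operatorname{dom} s$. Put $\tau(s,t)=(\beta_k,\dots,\beta_1)$,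 and let $\tau(t,t)$ be the empty sequence. Let $\ell(s,t)$ be the length of $\tau(s,t)$. The $\Lambda$-duplicate: $D=\Lambda\times\{1,-1\}$. For $(t,i)\in D$ and $r\in\Lambda\cup\{0\}$ with $r\prec t$, let $$W(r,t,i)=\{(s,j)\in D : s\in(r,t]\text{ and } j=(-1)^{\ell(s,t)}i\}.$$ The sets $W(r,t,i)$ form a basis for a locally compact (Hausdorff) topology on $D$; $D$ with this topology is called the $\Lambda$-duplicate. A space $X$ has $( * )$ if there exists a sequence $(\mathscr{U}_n)_{n=1}^\infty$ of families of open subsets of $X$ such that for any distinct $x,y\in X$ there exists $n$ such that (1) $\{x,y\}\cap\bigcup\mathscr{U}_n$ is non-empty, and (2) $\{x,y\}\cap U$ is at most a singleton for all $U\in\mathscr{U}_n$. A space $X$ is Gruenhage if there exist a sequence $(\mathscr{U}_n)_{n=1}^\infty$ of families of open subsets of $X$ and sets $R_n$, $n\ge1$, such that (1) for any distinct $x,y\in X$ there exist $n$ and $U\in\mathscr{U}_n$ such that $\{x,y\}\cap U$ is a singleton, and (2) $U\cap V=R_n$ whenever $U,V\in\mathscr{U}_n$ are distinct. $C(K)$ is the Banach space of continuous real-valued functions on $K$. A norm $\|\cdot\|$ on $C(K)$ is a lattice norm if $\|f\|\le\|g\|$ whenever $|f|\le|g|$ pointwise. A norm is strictly convex if every element of the unit sphere is an extreme point of the unit ball. *)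

(* Defs.v *)
From HB Require Import structures.
From mathcomp Require Import all_boot all_order all_algebra.
From mathcomp Require Import all_classical all_reals all_analysis.

Set Implicit Arguments.
Unset Strict Implicit.
Unset Printing Implicit Defensive.

Import Order.TTheory GRing.Theory Num.Theory.
Import numFieldNormedType.Exports.

Local Open Scope classical_set_scope.
Local Open Scope ring_scope.

Definition wo_pow : rel (set nat) :=
  projT1 (@wochoice.well_ordering_principle (set nat)).

(* The type of countable ordinals: an initial segment of a well-ordered
   uncountable set, of order type omega_1 by omega1_ex_min,
   omega1_countable_segment and omega1_uncountable. *)
Definition omega1 : Type :=
  {a : set nat | `[< countable [set b | wo_pow b a] >]}.

HB.instance Definition _ := Choice.on omega1.

Definition omega1_le (a b : omega1) : bool := wo_pow (val a) (val b).

Lemma wo_pow_well_order : wochoice.well_order wo_pow.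
Proof. exact: projT2 (@wochoice.well_ordering_principle (set nat)). Qed.

Lemma wo_pow_ex_min (A : set (set nat)) :
  A !=set0 -> exists2 z, A z & forall x, A x -> wo_pow z x.
Proof.
move=> [x Ax].
have [|z [[/asboolP Az zmin] _]] := @wo_pow_well_order [pred y | `[< A y >]].
  by exists x; apply/asboolP.
by exists z => // y Ay; apply: zmin; apply/asboolP.
Qed.

Lemma wo_pow_refl : reflexive wo_pow.
Proof.
move=> x; have := @wochoice.wo_chain_reflexive _ wo_pow predT.
by move=> /(_ (wochoice.withinW wo_pow_well_order)); apply.
Qed.

Lemma wo_pow_anti : antisymmetric wo_pow.
Proof.
move=> x y; have := @wochoice.wo_chain_antisymmetric _ wo_pow predT.
by move=> /(_ (wochoice.withinW wo_pow_well_order)); apply.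
Qed.

Lemma wo_pow_total : total wo_pow.
Proof.
move=> x y; have := @wochoice.wo_chainW _ wo_pow predT.
by move=> /(_ (wochoice.withinW wo_pow_well_order)); apply.
Qed.

Lemma wo_pow_trans : transitive wo_pow.
Proof.
move=> y x z xy yz.
have [|m] := @wo_pow_ex_min [set w | w = x \/ w = y \/ w = z].
  by exists x; left.
move=> [->|[->|->]] mmin.
- by apply: mmin; right; right.
- have yx : wo_pow y x by apply: mmin; left.
  by rewrite (@wo_pow_anti x y) ?xy.
- have zy : wo_pow z y by apply: mmin; right; left.
  by rewrite -(@wo_pow_anti y z) ?yz.
Qed.

Lemma omega1_le_refl : reflexive omega1_le.
Proof. by move=> x; exact: wo_pow_refl. Qed.

Lemma omega1_le_anti : antisymmetric omega1_le.
Proof. by move=> x y /wo_pow_anti/val_inj. Qed.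

Lemma omega1_le_trans : transitive omega1_le.
Proof. by move=> x y z; exact: wo_pow_trans. Qed.

Fact omega1_display : Order.disp_t. Proof. exact: Order.Disp tt tt. Qed.

HB.instance Definition _ := Order.Le_isPOrder.Build omega1_display omega1
  omega1_le_refl omega1_le_anti omega1_le_trans.

Lemma omega1_le_total : total (<=%O : rel omega1).
Proof. by move=> x y; exact: wo_pow_total. Qed.

HB.instance Definition _ :=
  Order.POrder_isTotal.Build omega1_display omega1 omega1_le_total.

Local Open Scope order_scope.

Lemma omega1_ex_min (A : set omega1) :
  A !=set0 -> exists2 z, A z & forall x, A x -> z <= x.
Proof.
move=> [x Ax]; have [|_ [z Az <-] zmin] := @wo_pow_ex_min (val @` A).
  by exists (val x), x.
by exists z => // y Ay; apply: zmin; exists y.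
Qed.

Lemma omega1_countable_segment (a : omega1) : countable [set b | b <= a].
Proof.
have /asboolP/countable_injP[f finj] := valP a.
apply/countable_injP; exists (f \o val) => b c /set_mem/= ba /set_mem/= ca.
by move=> /finj/val_inj; apply; rewrite inE.
Qed.

Lemma omega1_uncountable : ~ countable [set: omega1].
Proof.
move=> cO.
have seg a : ~ countable [set b | wo_pow b a] ->
    exists a0 : set nat, ~ countable [set b | wo_pow b a0] /\
      forall b, wo_pow b a0 -> b <> a0 -> countable [set c | wo_pow c b].
  move=> Na; have [|a0 Na0 a0min] :=
    @wo_pow_ex_min [set b | ~ countable [set c | wo_pow c b]]; first by exists a.
  exists a0; split=> // b ba0 bNa0; apply: contrapT => /a0min a0b.
  by apply: bNa0; apply: wo_pow_anti; rewrite ba0.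
have [f finj] : exists f : omega1 -> nat, injective f.
  have /countable_injP[f finj] := cO.
  by exists f => x y; apply: finj; rewrite inE.
have [[a /seg [a0 [Na0 a0min]]]|/forallNP Cseg] :=
    pselect (exists a : set nat, ~ countable [set b | wo_pow b a]).
  apply: Na0.
  have lift b : exists c : omega1, wo_pow b a0 -> b <> a0 -> val c = b.
    have [[ba0 bNa0]|Nb] := pselect (wo_pow b a0 /\ b <> a0).
      have Pb : `[< countable [set c | wo_pow c b] >].
        by apply/asboolP; exact: a0min.
      by exists (exist _ b Pb).
    have [|z _ zmin] := @wo_pow_ex_min setT; first by exists a0.
    have Pz : `[< countable [set c | wo_pow c z] >].
      apply/asboolP; apply: (@sub_countable _ _ _ [set z]) => //.
      by apply: subset_card_le => x xz; apply: wo_pow_anti; rewrite xz zmin.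
    by exists (exist _ z Pz) => ba bN; case: Nb.
  pose g b := projT1 (cid (lift b)).
  have gP b : wo_pow b a0 -> b <> a0 -> val (g b) = b.
    exact: projT2 (cid (lift b)).
  apply/countable_injP.
  exists (fun b => if pselect (b = a0) then 0%N else (f (g b)).+1) => b c.
  move=> /set_mem ba /set_mem ca.
  case: pselect => [b0|bN]; case: pselect => [c0|cN] //=.
    by rewrite b0 c0.
  by move=> [/finj gE]; rewrite -(gP b)// gE gP.
have Pall b : `[< countable [set c : set nat | wo_pow c b] >].
  by apply/asboolP; apply: contrapT => /(Cseg b).
pose g b : omega1 := exist _ b (Pall b).
have ginj b c : f (g b) = f (g c) -> b = c by move=> /finj/(congr1 val).
pose B : set nat := [set n | exists2 A, f (g A) = n & ~ A n].
have [BfB|NBfB] := pselect (B (f (g B))).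
  by have [A /ginj AB NA] := BfB; apply: NA; rewrite AB.
by apply: (NBfB); exists B.
Qed.

(* A function t : alpha -> omega is encoded by alpha and a function on omega1
   that is 0 from alpha on, so that Leibniz equality is equality of t. *)
Record Lambda := MkLambda {
  dom : omega1;
  lfun :> omega1 -> nat;
  lfun_out : forall a, dom <= a -> lfun a = 0%N;
  lfun_inj : forall a b, a < dom -> b < dom -> lfun a = lfun b -> a = b;
  lfun_coinf : infinite_set (~` (lfun @` [set a | a < dom]))
}.

HB.instance Definition _ := gen_eqMixin Lambda.
HB.instance Definition _ := gen_choiceMixin Lambda.

Definition lam_le (s t : Lambda) : Prop :=
  dom s <= dom t /\ forall a, a < dom s -> t a = s a.

Definition lam_lt (s t : Lambda) : Prop := lam_le s t /\ s <> t.

(* Elements r of Lambda + {0}; None is the extra element 0. *)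
Definition lam_lt0 (r : option Lambda) (t : Lambda) : Prop :=
  if r is Some r' then lam_lt r' t else True.

Definition lam_itv (r : option Lambda) (t : Lambda) : set Lambda :=
  [set s | lam_lt0 r s /\ lam_le s t].

(* Equal to dom s when b <= dom s, so that beta below is eventually dom s. *)
Definition next_beta (s t : Lambda) (b : omega1) : omega1 :=
  xget (dom s) [set c | dom s <= c < b /\
                  forall x, dom s <= x < b -> (t c <= t x)%N].

Definition beta (s t : Lambda) (i : nat) : omega1 :=
  iter i (next_beta s t) (dom t).

Lemma next_betaE (s t : Lambda) (b c : omega1) : b <= dom t ->
  dom s <= c < b -> (forall x, dom s <= x < b -> (t c <= t x)%N) ->
  next_beta s t b = c.
Proof.
move=> bt cb cmin; apply: xget_subset1 => // x y [xb xmin] [yb ymin].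
apply: (@lfun_inj t).
- by case/andP: xb => _ /lt_le_trans; apply.
- by case/andP: yb => _ /lt_le_trans; apply.
- by apply/eqP; rewrite eqn_leq xmin // ymin.
Qed.

Lemma next_betaP (s t : Lambda) (b : omega1) : dom s < b ->
  dom s <= next_beta s t b < b /\
  forall x, dom s <= x < b -> (t (next_beta s t b) <= t x)%N.
Proof.
move=> sb; rewrite /next_beta; case: xgetP => [c _ [//]|].
move=> noc; exfalso.
have exn : exists n, `[< exists2 c, dom s <= c < b & t c = n >].
  by exists (t (dom s)); apply/asboolP; exists (dom s) => //; rewrite lexx sb.
case: (ex_minnP exn) => n /asboolP[c cb tcn] nmin.
by apply: (noc c); split=> // x xb; rewrite tcn nmin//; apply/asboolP; exists x.
Qed.

Lemma next_beta_out (s t : Lambda) (b : omega1) : b <= dom s ->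
  next_beta s t b = dom s.
Proof.
move=> bs; rewrite /next_beta; case: xgetP => [c _ [/andP[sc cb] _]|//].
by have := lt_le_trans (le_lt_trans sc cb) bs; rewrite ltxx.
Qed.

Lemma iter_next_beta_stops (s t : Lambda) (b : omega1) :
  exists i, iter i (next_beta s t) b == dom s.
Proof.
apply: contrapT => Nb.
have [|c Nc cmin] := @omega1_ex_min
    [set b | ~ exists i, iter i (next_beta s t) b == dom s]; first by exists b.
have [cs|sc] := leP c (dom s).
  by apply: Nc; exists 1%N; rewrite /= next_beta_out.
have [/andP[_ nc] _] := next_betaP t sc.
have [i iE] : exists i, iter i (next_beta s t) (next_beta s t c) == dom s.
  by apply: contrapT => /cmin; rewrite leNgt nc.
by apply: Nc; exists i.+1; rewrite iterSr.
Qed.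

Lemma beta_stops (s t : Lambda) : exists i, beta s t i == dom s.
Proof. exact: iter_next_beta_stops. Qed.

Definition stage (s t : Lambda) : nat := ex_minn (beta_stops s t).

Definition tau (s t : Lambda) : seq omega1 :=
  rev [seq beta s t i.+1 | i <- iota 0 (stage s t)].

Definition ell (s t : Lambda) : nat := size (tau s t).

(* b : bool stands for the sign (-1) ^+ b. *)
Definition duplicate : Type := (Lambda * bool)%type.

HB.instance Definition _ := Choice.on duplicate.

Definition sign (b : bool) : int := ((-1) ^+ b)%R.

Definition W (r : option Lambda) (t : Lambda) (i : bool) : set duplicate :=
  [set x | lam_itv r t x.1 /\
           sign x.2 = ((-1) ^+ ell x.1 t * sign i)%R].

Lemma Lambda_eq (s t : Lambda) : dom s = dom t ->
  (forall a, a < dom s -> t a = s a) -> s = t.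
Proof.
case: s t => [d f fo fi fc] [e g go gi gc] /= de fg; subst e.
have fgE : f = g.
  by apply/funext => a; have [/fg->//|da] := ltP a d; rewrite fo ?go.
by subst g; congr MkLambda; exact: Prop_irrelevance.
Qed.

Lemma lam_le_refl t : lam_le t t. Proof. by split. Qed.

Lemma lam_le_trans t s u : lam_le s t -> lam_le t u -> lam_le s u.
Proof.
move=> [st stE] [tu tuE]; split; first exact: le_trans tu.
by move=> a ads; rewrite tuE ?stE//; exact: lt_le_trans st.
Qed.

Lemma lam_le_eq s t : lam_le s t -> dom s = dom t -> s = t.
Proof. by move=> [_ stE] /Lambda_eq; apply. Qed.

Lemma lam_ltP s t : lam_lt s t <-> lam_le s t /\ dom s < dom t.
Proof.
split=> [[st sNt]|[st dst]]; split=> //.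
- rewrite lt_neqAle (proj1 st) andbT; apply/eqP => /(lam_le_eq st).
  exact: sNt.
- by move=> stE; rewrite stE ltxx in dst.
Qed.

Lemma lam_lt_le_trans s t u : lam_lt s t -> lam_le t u -> lam_lt s u.
Proof.
move=> /lam_ltP[st dst] tu; apply/lam_ltP; split; first exact: lam_le_trans tu.
exact: lt_le_trans (proj1 tu).
Qed.

Lemma lam_le_lt_trans s t u : lam_le s t -> lam_lt t u -> lam_lt s u.
Proof.
move=> st /lam_ltP[tu dtu]; apply/lam_ltP; split; first exact: lam_le_trans tu.
exact: le_lt_trans (proj1 st) dtu.
Qed.

Lemma lam_lt0_le_trans r s t : lam_lt0 r s -> lam_le s t -> lam_lt0 r t.
Proof. by case: r => // r; exact: lam_lt_le_trans. Qed.

Lemma lam_lt0_max (r1 r2 : option Lambda) t : lam_lt0 r1 t -> lam_lt0 r2 t ->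
  exists q, [/\ lam_lt0 q t, forall s, lam_lt0 q s -> lam_lt0 r1 s &
                forall s, lam_lt0 q s -> lam_lt0 r2 s].
Proof.
case: r1 r2 => [r1|] [r2|] h1 h2; first last.
- by exists None.
- by exists (Some r2).
- by exists (Some r1).
wlog r12 : r1 r2 h1 h2 / dom r1 <= dom r2.
  move=> wl; have [/wl|/ltW/wl] := leP (dom r1) (dom r2); first exact.
  by move=> /(_ h2 h1)[q [? ? ?]]; exists q.
exists (Some r2); split=> // s; apply: lam_le_lt_trans; split=> // a ar1.
have [[_ E1] _] := h1; have [[_ E2] _] := h2.
have ar2 : a < dom r2 := lt_le_trans ar1 r12.
by rewrite -E1// -E2.
Qed.

Section restriction.
Variables (t : Lambda) (d : omega1).
Hypothesis dt : d < dom t.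

Let f (a : omega1) : nat := if a < d then t a else 0%N.

Let f_out a : d <= a -> f a = 0%N.
Proof. by rewrite /f ltNge => ->. Qed.

Let f_inj a b : a < d -> b < d -> f a = f b -> a = b.
Proof.
move=> ad bd; rewrite /f ad bd; apply: lfun_inj.
  exact: lt_trans dt.
exact: lt_trans dt.
Qed.

Let f_coinf : infinite_set (~` (f @` [set a | a < d])).
Proof.
apply: sub_infinite_set (@lfun_coinf t) => n nt [a /= ad].
rewrite /f ad => tan; apply: nt; exists a => //=; exact: lt_trans dt.
Qed.

Definition lam_restr := MkLambda f_out f_inj f_coinf.

Lemma lam_restr_lt : lam_lt lam_restr t.
Proof.
apply/lam_ltP; split=> //; split=> /=; first exact: ltW.
by move=> a ad; rewrite /f ad.
Qed.

End restriction.

Lemma lam_tail_gt (u : Lambda) (n : nat) : exists2 q, lam_lt0 q u &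
  forall s, lam_lt0 q s -> forall x, dom s <= x < dom u -> (n <= u x)%N.
Proof.
elim: n => [|n [q qu qP]]; first by exists None.
have [[x xu uxn]|noX] := pselect (exists2 x, x < dom u & u x = n); last first.
  exists q => // s /qP sP x /andP[sx xu].
  rewrite ltn_neqAle sP ?sx// andbT; apply/eqP => nux.
  by apply: noX; exists x.
have [p [pu pq pr]] := lam_lt0_max qu (lam_restr_lt xu : lam_lt0 (Some _) u).
exists p => // s ps y /andP[sy yu].
rewrite ltn_neqAle (qP _ (pq _ ps)) ?sy// andbT; apply/eqP => nuy.
have /lam_ltP[_ /= xs] := pr _ ps.
have xy : x = y by apply: (@lfun_inj u) => //; rewrite uxn.
by have := lt_le_trans xs sy; rewrite xy ltxx.
Qed.

Lemma ellE s t : ell s t = stage s t.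
Proof. by rewrite /ell size_rev size_map size_iota. Qed.

Lemma ellxx t : ell t t = 0%N.
Proof.
rewrite ellE /stage; case: ex_minnP => n _ /(_ 0%N).
by rewrite /beta eqxx leqn0 => /(_ isT)/eqP.
Qed.

Lemma ellD s u t : lam_le s u -> lam_le u t ->
  (forall x, dom s <= x < dom u -> (t (dom u) <= u x)%N) ->
  ell s t = (ell u t + ell s u)%N.
Proof.
move=> [su _] ut tail.
have [|utd] := eqVneq (dom u) (dom t).
  by move=> /(lam_le_eq ut) <-; rewrite ellxx.
have {utd} utd : dom u < dom t by rewrite lt_neqAle utd (proj1 ut).
have le_next b : dom u < b -> b <= dom t -> next_beta s t b = next_beta u t b.
  move=> ub bt; have [/andP[un nb] nmin] := next_betaP t ub.
  apply: next_betaE => //; first by rewrite nb (le_trans su).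
  move=> x /andP[sx xb]; have [ux|xu] := leP (dom u) x.
    by apply: nmin; rewrite ux.
  apply: (@leq_trans (t (dom u))); first by rewrite nmin// lexx ub.
  by rewrite (proj2 ut x xu) tail// sx.
have next_le b : b <= dom u -> next_beta s t b = next_beta s u b.
  move=> bu; have [bs|sb] := leP b (dom s); first by rewrite !next_beta_out.
  have [/andP[sn nb] nmin] := next_betaP u sb.
  apply: next_betaE; first exact: le_trans (proj1 ut).
    by rewrite sn nb.
  move=> x /andP[sx xb]; rewrite !(proj2 ut) ?nmin ?sx//.
    exact: lt_le_trans bu.
  exact: lt_le_trans bu.
rewrite !ellE /stage.
case: (ex_minnP (beta_stops u t)) => m /eqP mE mmin.
case: (ex_minnP (beta_stops s u)) => k /eqP kE kmin.
have low i : (i <= m)%N ->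
    [/\ beta s t i = beta u t i, dom u <= beta u t i & beta u t i <= dom t].
  elim: i => [_|i IH im]; first by rewrite /beta/= lexx ltW.
  have [iE iu it] := IH (ltnW im).
  have {}iu : dom u < beta u t i.
    rewrite lt_neqAle iu andbT eq_sym; apply/eqP => /eqP/mmin.
    by rewrite leqNgt im.
  have [/andP[un nb] _] := next_betaP t iu.
  rewrite /beta !iterS -!/(beta _ _ _) iE le_next//; split=> //.
  exact: le_trans (ltW nb) it.
have high i : beta s t (m + i) = beta s u i /\ beta s u i <= dom u.
  elim: i => [|i [IH iu]].
    by rewrite addn0; have [-> _ _] := low m (leqnn _); rewrite mE /beta/=.
  rewrite addnS /beta !iterS -!/(beta _ _ _) IH next_le//; split=> //.
  have [bs|sb] := leP (beta s u i) (dom s); first by rewrite next_beta_out.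
  have [/andP[_ /ltW nb] _] := next_betaP u sb.
  exact: le_trans nb iu.
case: ex_minnP => n /eqP nE nmin; apply/eqP; rewrite eqn_leq; apply/andP; split.
  by apply: nmin; rewrite (proj1 (high k)) kE.
have [mn|nm] := leqP m n.
  rewrite -(subnKC mn) leq_add2l kmin// -(proj1 (high _)) subnKC//.
  by rewrite nE.
exfalso; have [nE' un _] := low n (ltnW nm).
have : beta u t n == dom u by rewrite eq_le un andbT -nE' nE.
by move/mmin; rewrite leqNgt nm.
Qed.

Lemma W_center r t i : lam_lt0 r t -> W r t i (t, i).
Proof.
by move=> rt; split; [split=> //; exact: lam_le_refl|rewrite ellxx mul1r].
Qed.

Lemma W_sub r t i u j : W r t i (u, j) ->
  exists2 q, lam_lt0 q u & forall p, lam_lt0 p u ->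
    (forall s, lam_lt0 p s -> lam_lt0 q s) -> W p u j `<=` W r t i.
Proof.
move=> [/= [ru ut] jE].
have [q qu qP] := lam_tail_gt u (t (dom u)).
have [q' [q'u q'q q'r]] := lam_lt0_max qu ru.
exists q' => // p pu pq [s k] [/= [ps su] kE]; split=> /=.
  by split; [apply/q'r/pq|exact: lam_le_trans ut].
rewrite (@ellD s u t)//; last by apply: qP; apply/q'q/pq.
by rewrite kE jE exprD mulrA [(_ * (-1) ^+ ell u t)%R]mulrC.
Qed.

Lemma W_base r t i r' t' i' x : W r t i x -> W r' t' i' x ->
  exists2 q, lam_lt0 q x.1 & W q x.1 x.2 `<=` W r t i `&` W r' t' i'.
Proof.
case: x => u j /W_sub[p pu pP] /W_sub[q qu qP].
have [m [mu mp mq]] := lam_lt0_max pu qu; exists m => //=.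
by rewrite subsetI; split; [exact: pP|exact: qP].
Qed.

Lemma lam_empty_subproof : {z : omega1 | forall x, z <= x}.
Proof.
apply: cid; have /set0P[a _] : [set: omega1] != set0.
  apply/eqP => O0; apply: omega1_uncountable; rewrite O0; exact: countable0.
by have [|z _ zmin] := @omega1_ex_min setT; [exists a|exists z => x; apply: zmin].
Qed.

Lemma lam_empty_coinf (z : omega1) : (forall x, z <= x) ->
  infinite_set (~` ((fun=> 0%N) @` [set a : omega1 | a < z])).
Proof.
move=> zmin; rewrite (_ : [set a | _] = set0) ?image_set0 ?setC0.
  exact: infinite_nat.
by rewrite -subset0 => a /=; rewrite ltNge zmin.
Qed.

Lemma lam_empty_inj (z : omega1) : (forall x, z <= x) ->
  forall a b : omega1, a < z -> b < z -> 0%N = 0%N -> a = b.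
Proof. by move=> zmin a b; rewrite ltNge zmin. Qed.

Definition lam_empty : Lambda :=
  let: exist z zmin := lam_empty_subproof in
  @MkLambda z (fun=> 0%N) (fun _ _ => erefl) (lam_empty_inj zmin)
    (lam_empty_coinf zmin).

HB.instance Definition _ := isPointed.Build Lambda lam_empty.

Definition W_index : Type := (option Lambda * (Lambda * bool))%type.

HB.instance Definition _ := Choice.on W_index.
HB.instance Definition _ :=
  isPointed.Build W_index (None, (lam_empty, false)).

Definition W_dom : set W_index := [set k | lam_lt0 k.1 k.2.1].

Definition W_of (k : W_index) : set duplicate := W k.1 k.2.1 k.2.2.

Lemma W_of_cover : \bigcup_(k in W_dom) W_of k = setT.
Proof.
rewrite -subTset => -[t i] _; exists (None, (t, i)) => //.
exact: W_center.
Qed.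

Lemma W_of_join (k l : W_index) (x : duplicate) : W_dom k -> W_dom l ->
  W_of k x -> W_of l x ->
  exists m, [/\ W_dom m, W_of m x & W_of m `<=` W_of k `&` W_of l].
Proof.
move=> _ _ kx lx; have [q qx qW] := W_base kx lx.
by exists (q, x); split=> //; case: x {kx lx qW} qx => t i; exact: W_center.
Qed.

HB.instance Definition _ :=
  isBaseTopological.Build duplicate W_of_cover W_of_join.

Definition compact_duplicate : Type := one_point_compactification duplicate.

HB.instance Definition _ := Topological.on compact_duplicate.

Local Close Scope order_scope.

Definition scattered (X : topologicalType) : Prop :=
  forall U : set X, open U -> U !=set0 -> isolated U !=set0.

(* Sequences indexed by n >= 1 are indexed here by n >= 0. *)
Definition has_star (X : topologicalType) : Prop :=
  exists U_ : nat -> set_system X,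
    (forall n U, U_ n U -> open U) /\
    forall x y : X, x <> y -> exists n,
      [set x; y] `&` \bigcup_(U in U_ n) U !=set0 /\
      forall U, U_ n U -> is_subset1 ([set x; y] `&` U).

Definition gruenhage (X : topologicalType) : Prop :=
  exists (U_ : nat -> set_system X) (R_ : nat -> set X),
    [/\ forall n U, U_ n U -> open U,
        forall x y : X, x <> y -> exists n, exists2 U, U_ n U &
          exists z, [set x; y] `&` U = [set z] &
        forall n U V, U_ n U -> U_ n V -> U <> V -> U `&` V = R_ n].

Definition Cspace (K : topologicalType) (R : realType) : Type :=
  continuousType K R^o.

HB.instance Definition _ K R := Choice.on (Cspace K R).

Section Cspace_lmodType.
Variables (K : topologicalType) (R : realType).
Implicit Types f g h : Cspace K R.

Let zero_cts : continuous ((fun=> 0) : K -> R^o).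
Proof. by move=> x; exact: cvg_cst. Qed.

Let opp_cts f : continuous ((fun x => - f x) : K -> R^o).
Proof. by move=> x; apply: cvgN; exact: cts_fun. Qed.

Let add_cts f g : continuous ((fun x => f x + g x) : K -> R^o).
Proof. by move=> x; apply: cvgD; exact: cts_fun. Qed.

Let scale_cts (a : R) f : continuous ((fun x => a * f x) : K -> R^o).
Proof. by move=> x; apply: cvgM; [exact: cvg_cst|exact: cts_fun]. Qed.

Definition C_zero : Cspace K R := mkcts zero_cts.
Definition C_opp f : Cspace K R := mkcts (@opp_cts f).
Definition C_add f g : Cspace K R := mkcts (@add_cts f g).
Definition C_scale (a : R) f : Cspace K R := mkcts (@scale_cts a f).

Let addA : associative C_add.
Proof. by move=> f g h; apply/continuousEP => x /=; exact: addrA. Qed.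

Let addC : commutative C_add.
Proof. by move=> f g; apply/continuousEP => x /=; exact: addrC. Qed.

Let add0 : left_id C_zero C_add.
Proof. by move=> f; apply/continuousEP => x /=; exact: add0r. Qed.

Let addN : left_inverse C_zero C_opp C_add.
Proof. by move=> f; apply/continuousEP => x /=; exact: addNr. Qed.

HB.instance Definition _ :=
  GRing.isZmodule.Build (Cspace K R) addA addC add0 addN.

Let scaleA a b f : C_scale a (C_scale b f) = C_scale (a * b) f.
Proof. by apply/continuousEP => x /=; exact: mulrA. Qed.

Let scale1 : left_id 1 C_scale.
Proof. by move=> f; apply/continuousEP => x /=; exact: mul1r. Qed.

Let scaleDr : right_distributive C_scale +%R.
Proof. by move=> a f g; apply/continuousEP => x /=; exact: mulrDr. Qed.

Let scaleDl f : {morph C_scale^~ f : a b / a + b}.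
Proof. by move=> a b; apply/continuousEP => x /=; exact: mulrDl. Qed.

HB.instance Definition _ := GRing.Zmodule_isLmodule.Build R (Cspace K R)
  scaleA scale1 scaleDr scaleDl.

End Cspace_lmodType.

Definition sup_norm (K : topologicalType) (R : realType) (f : Cspace K R) : R :=
  sup [set `|f x| | x in [set: K]].

Section norms.
Variables (R : realType) (V : lmodType R).

Definition is_norm (N : V -> R) : Prop :=
  [/\ forall f, 0 <= N f,
      forall f, N f = 0 -> f = 0,
      forall (a : R) f, N (a *: f) = `|a| * N f &
      forall f g, N (f + g) <= N f + N g].

Definition equivalent_norms (N M : V -> R) : Prop :=
  exists c C : R, [/\ 0 < c, 0 < C & forall f, c * M f <= N f <= C * M f].

(* The bounded linear functionals, as a subspace of V -> R^o. *)
Definition dual (N : V -> R) : set (V -> R^o) :=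
  [set phi | linear phi /\ exists C : R, forall f, `|phi f| <= C * N f].

Definition dual_norm (N : V -> R) (phi : V -> R^o) : R :=
  sup [set `|phi f| | f in [set f | N f <= 1]].

Definition extreme_point (A : set V) (x : V) : Prop :=
  A x /\ forall (y z : V) (a : R), A y -> A z -> 0 < a < 1 ->
    x = a *: y + (1 - a) *: z -> y = z.

(* N is considered as a norm on the subspace E of V. *)
Definition strictly_convex (E : set V) (N : V -> R) : Prop :=
  forall x, E x -> N x = 1 -> extreme_point [set y | E y /\ N y <= 1] x.

End norms.

Definition lattice_norm (K : topologicalType) (R : realType)
    (N : Cspace K R -> R) : Prop :=
  forall f g : Cspace K R, (forall x, `|f x| <= `|g x|) -> N f <= N g.

(* Main.v *)
Require Import Defs.
From mathcomp Require Import all_boot all_order all_algebra.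
From mathcomp Require Import all_classical all_reals all_analysis.
From mathcomp Require Import ring lra.

(** Elements of Lambda are injective sequences of integers. So for every t in
    Lambda and every integer n there is r < t such that t >= n on
    [dom s, dom t) for all s in (r, t]. The property (star) and the norm both rest
    on this fact.

    Topology. An interval of Lambda below t is a countable ordinal interval,
    and a basic set W r t i is a homeomorphic copy of it, hence compact open
    ([W_compact]). So K is compact, Hausdorff and zero-dimensional, and a point
    of D of least height in a set is isolated in it. Shrinking the basic
    neighbourhoods of (t, i) until t >= n on them gives open covers
    [tail_cover n] of D. If s < t both lie below u with u >= n from dom s on,
    then t (dom s) = u (dom s) >= n; hence a pair of distinct points is
    eventually separated by these covers. This is a G_delta-diagonal of D, and
    yields the property (star).

    K is not Gruenhage. Families as in the definition would separate (t, 1)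
    from (t, -1) for every t, and so would write Lambda as a countable union of
    sets Q n on each of which the witness U t is an open set that contains
    (t, i), avoids (t, -i), and satisfies U s = U t as soon as U t contains
    (s, i). A Baire category argument on Lambda excludes this
    ([no_countable_rigid_separation]): one builds an increasing sequence in
    Lambda, keeping a growing finite set of integers forbidden. When an element
    s of Q n is met, the next two values decide the parity of ell s t for all
    permitted t above ([parity_extension]). An even parity puts (s, i) in any
    neighbourhood W r t i with r < s, and so forces U s = U t; an odd parity
    puts (s, -i) there, which is contradictory once U s = U t is known. With
    the choices made in [escape_step] the limit lies in no Q n.

    The norm. As K is compact and scattered, every functional on C(K) is a norm
    limit of finite combinations of evaluations ([functional_atomic]), so it
    is given by its point masses mu phi x. For the total variation, the sup of
    |phi|(U) over the unions U of k members of [tail_cover n] tends, as n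
    grows, to the sum of the k largest |mu phi x| with x in D
    ([sum_mu_le_unions], [unions_le_sum_mu]). If these sups and the total
    variation agree for phi, psi and for a proper convex combination theta,
    then a set of k largest masses for theta is one for phi and psi too, with
    the same sum; adding points one at a time gives |mu phi| = |mu psi|, and
    strict convexity of the real line removes the modulus
    ([eq_of_equal_masses]). It remains to produce an equivalent lattice norm
    whose dual norm is the l2-sum of the countably many seminorms with weights
    2^-(i+1). It is the supremum of s(|f|) over the finitely supported
    positive measures s whose l2-sum is at most 1 ([renorm]): since functionals
    are approximated by such measures, a functional phi with l2-sum at most rho
    satisfies |phi f| <= rho N f for this norm N ([sum_weighted_mass_le]), and
    the converse for rho = 1 follows by testing phi on a suitable sum of almost
    norming functions ([sum_weighted_mass_le1]). *)

Set Implicit Arguments.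
Unset Strict Implicit.
Unset Printing Implicit Defensive.

Import Order.TTheory GRing.Theory Num.Theory.
Import numFieldNormedType.Exports.

Local Open Scope classical_set_scope.
Local Open Scope ring_scope.

(** * Compactness as an induction principle *)

(** Finite subcovers in inductive form, free of any indexing of the cover: the
    supersets of the members of the ideal P form a filter base, to which
    near-covering applies. *)
Lemma compact_ind (X : topologicalType) (P : set X -> Prop) (A : set X) :
  P set0 -> (forall B C, P B -> P C -> P (B `|` C)) ->
  compact A -> (forall x, A x -> exists2 U, nbhs x U & P U) ->
  exists2 B, P B & A `<=` B.
Proof.
move=> P0 PU /compact_near_coveringP cA AP.
pose F := filter_from P (fun B => [set C | B `<=` C]).
have FF : Filter F.
  apply: filter_from_filter; first by exists set0.
  move=> B C PB PC; exists (B `|` C); first exact: PU.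
  by move=> E; rewrite /= subUset => -[].
have [|B PB BA] := cA _ F (fun C x => C x) FF.
  move=> x /AP[U xU PU']; exists (U, [set C | U `<=` C]) => /=.
    by split=> //; exists U.
  by move=> [y C] /= [Uy UC]; exact: UC.
by exists B => //; exact: BA.
Qed.

(** The converse of [compact_ind]; it reduces compactness of an ordinal interval
    to well-founded induction on its endpoint. *)
Lemma compact_of_ind (X : topologicalType) (A : set X) :
  (forall P : set X -> Prop, P set0 ->
    (forall B C, P B -> P C -> P (B `|` C)) ->
    (forall B C, B `<=` C -> P C -> P B) ->
    (forall x, A x -> exists2 U, nbhs x U & P U) -> P A) -> compact A.
Proof.
move=> Aind; apply/compact_near_coveringP => I F P FF AP.
apply: (Aind (fun B => \forall i \near F, B `<=` P i)).
- by apply: filterE => i x.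
- by move=> B C; apply: filterS2 => i BP CP; rewrite subUset.
- by move=> B C BC; apply: filterS => i; exact: subset_trans.
- move=> x /AP[[U V] /= [xU FV] UVP]; exists U => //.
  by apply: filterS FV => i Vi y Uy; apply: (UVP (y, i)).
Qed.

(** * The topology of the duplicate *)

Section order.
Local Open Scope order_scope.
Local Open Scope classical_set_scope.

Lemma omega1_ind (P : omega1 -> Prop) :
  (forall a, (forall b, b < a -> P b) -> P a) -> forall a, P a.
Proof.
move=> IH a; apply: contrapT => Na.
have [|b Nb bmin] := @omega1_ex_min [set b | ~ P b]; first by exists a.
apply: Nb; apply: IH => c cb; apply: contrapT => /bmin.
by rewrite leNgt cb.
Qed.

Lemma lam_le_common r s t : lam_le r t -> lam_le s t -> dom r <= dom s ->
  lam_le r s.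
Proof.
move=> [_ rt] [_ st] rs; split=> // a ar; rewrite -rt// -st//.
exact: lt_le_trans ar rs.
Qed.

Lemma lam_lt_le s t : lam_lt s t -> lam_le s t.
Proof. by case. Qed.

Lemma sign_inj : injective sign.
Proof. by case=> -[]. Qed.

Lemma sign_mul (n : nat) (i : bool) : ((-1) ^+ n * sign i)%R = sign (odd n (+) i).
Proof. by rewrite /sign -signr_odd -signr_addb. Qed.

Lemma WP r t i s j : W r t i (s, j) <-> lam_itv r t s /\ j = odd (ell s t) (+) i.
Proof.
rewrite /W /=; split=> -[rst jE]; split=> //; last by rewrite jE sign_mul.
by apply: sign_inj; rewrite jE sign_mul.
Qed.

Lemma W_open r t i : lam_lt0 r t -> open (W r t i).
Proof.
move=> rt; exists [set (r, (t, i))]; first by move=> _ ->.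
by rewrite bigcup_set1.
Qed.

Lemma nbhs_duplicateP (x : duplicate) (U : set duplicate) :
  nbhs x U <-> exists2 r, lam_lt0 r x.1 & W r x.1 x.2 `<=` U.
Proof.
rewrite nbhsE; split=> [[V [[D DW <-] [k Dk kx]] VU]|[r rt rU]].
  have [q qx qW] : exists2 q, lam_lt0 q x.1 & W q x.1 x.2 `<=` W_of k `&` W_of k.
    exact: (W_base kx kx).
  by exists q => // y /qW[ky _]; apply: VU; exists k.
exists (W r x.1 x.2) => //; split; first exact: W_open.
by case: x rt {rU} => t i; exact: W_center.
Qed.

Lemma W_opposite_disjoint r t r' i : W r t i `&` W r' t (~~ i) = set0.
Proof.
apply/seteqP; split=> // -[s j] [/WP[_ ->] /WP[_]].
by case: i; case: (odd _).
Qed.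

(** Elements below t are comparable. *)
Lemma lam_itv_split r t v : lam_lt v t ->
  lam_itv r t `<=` lam_itv (Some v) t `|` lam_itv r v.
Proof.
move=> vt s [rs st]; have [sv|vs] := leP (dom s) (dom v).
  by right; split=> //; apply: lam_le_common sv; [exact: st|exact: lam_lt_le].
left; split=> //=; apply/lam_ltP; split=> //.
by apply: lam_le_common (ltW vs); [exact: lam_lt_le vt|exact: st].
Qed.

(** Both signs are taken together because the parities of ell s t and ell s v
    agree for some s and differ for others: below v < t, the points of W r t i
    spread over W r v true and W r v false, whereas the union over the signs
    splits like an interval. The induction is on the height of the endpoint, as
    for ordinals. *)
Lemma tube_compact r t : compact [set x : duplicate | lam_itv r t x.1].
Proof.
apply: compact_of_ind => P P0 PU PS.
suff main d u : dom u = d ->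
    (forall x : duplicate, lam_itv r u x.1 -> exists2 U, nbhs x U & P U) ->
    P [set x : duplicate | lam_itv r u x.1].
  exact: (main (dom t)).
elim/omega1_ind: d u => d IH u du loc.
have [ru|Nru] := pselect (lam_lt0 r u); last first.
  apply: PS P0 => -[s j] /= [rs su]; apply: Nru; exact: lam_lt0_le_trans su.
have uu : lam_itv r u u by split=> //; exact: lam_le_refl.
have /(_ true)[p pu Pp] : forall i, exists2 p, lam_lt0 p u & P (W p u i).
  move=> i; have [U /nbhs_duplicateP[p pu pU] UP] := loc ((u, i) : duplicate) uu.
  by exists p => //; exact: PS UP.
have [q qu Pq] : exists2 p, lam_lt0 p u & P (W p u false).
  have [U /nbhs_duplicateP[q qu qU] UP] := loc ((u, false) : duplicate) uu.
  by exists q => //; exact: PS UP.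
have [m [mu mp mq]] := lam_lt0_max pu qu.
have Pm : P [set x : duplicate | lam_itv m u x.1].
  apply: PS (PU _ _ Pp Pq) => -[s j] /= [ms su].
  have [jE|jE] := eqVneq j (odd (ell s u) (+) true); [left|right].
    by apply/WP; split=> //; split=> //; exact: mp.
  apply/WP; split; first by split=> //; exact: mq.
  by move: jE; case: j; case: (odd _).
case: m mu mp mq Pm => [v|] vu _ _ Pm; last first.
  apply: PS Pm => -[s j] /= [_ su]; by split.
have [_ duv] := proj1 (lam_ltP _ _) vu.
have Pv : P [set x : duplicate | lam_itv r v x.1].
  apply: (IH (dom v)) => //; first by rewrite -du.
  move=> x [rx xv]; apply: loc; split=> //; exact: lam_le_trans (lam_lt_le vu).
apply: PS (PU _ _ Pm Pv) => -[s j] /= rs.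
exact: (lam_itv_split vu rs).
Qed.

(** In the tube over (r, t], W r t i is the complement of an open set, the basic
    set with the opposite sign. *)
Lemma W_compact r t i : lam_lt0 r t -> compact (W r t i).
Proof.
move=> rt; have -> : W r t i = [set x | lam_itv r t x.1] `&` ~` W r t (~~ i).
  apply/seteqP; split=> [x xW|[s j] [/= rst] NW].
    split; first by case: xW.
    by move=> xW'; rewrite -[False]/(set0 x) -(@W_opposite_disjoint r t r i).
  apply/WP; split=> //; apply: contrapT => jE; apply: NW; apply/WP; split=> //.
  by move: jE; case: j; case: i; case: (odd _).
apply: compact_closedI; first exact: tube_compact.
exact/open_closedC/W_open.
Qed.

(** For incomparable t and u, intervals that start where t and u first differ
    below are disjoint; for t < u, one starts the interval of u at t. *)
Lemma W_separate (x y : duplicate) : x <> y -> exists r r',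
  [/\ lam_lt0 r x.1, lam_lt0 r' y.1 & W r x.1 x.2 `&` W r' y.1 y.2 = set0].
Proof.
have below (t u : Lambda) i j : lam_lt t u -> W None t i `&` W (Some t) u j = set0.
  move=> tu; apply/seteqP; split=> // -[s k] [/WP[[_ st] _] /WP[[/= ts _] _]].
  by have [_] := lam_le_lt_trans st ts.
case: x y => [t i] [u j] /= xy; have [tu|tNu] := pselect (t = u).
  exists None, None; split=> //; rewrite -tu.
  have -> : j = ~~ i; last exact: W_opposite_disjoint.
  by case: i j xy => -[] //; rewrite tu.
have [tu|Ntu] := pselect (lam_le t u).
  by exists None, (Some t); split=> //; apply: below; split.
have [ut|Nut] := pselect (lam_le u t).
  exists (Some u), None; split=> //; first by split=> // /esym.
  by rewrite setIC below//; split=> // /esym.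
have [d [dt du tud]] : exists d, [/\ d < dom t, d < dom u & t d <> u d].
  apply: contrapT => Nd; have agree a : a < dom t -> a < dom u -> t a = u a.
    by move=> at' au; apply: contrapT => ?; apply: Nd; exists a.
  have [le|lt] := leP (dom t) (dom u).
    by apply: Ntu; split=> // a ad; rewrite agree//; exact: lt_le_trans le.
  by apply: Nut; split=> [|a ad]; [exact: ltW|rewrite agree//; exact: lt_trans lt].
exists (Some (lam_restr dt)), None; split=> //; first exact: lam_restr_lt.
apply/seteqP; split=> // -[s k] [/WP[[/= /lam_ltP[_ /= ds] [_ st]] _] /WP[[_ [_ su]] _]].
by apply: tud; rewrite st// su.
Qed.

Lemma duplicate_hausdorff : hausdorff_space duplicate.
Proof.
move=> x y xy; apply: contrapT => /W_separate[r [r' [rx ry W0]]].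
have [||z] := xy (W r x.1 x.2) (W r' y.1 y.2); last by rewrite W0.
  by apply/nbhs_duplicateP; exists r.
by apply/nbhs_duplicateP; exists r'.
Qed.

End order.

(** * The one-point compactification and its covers *)

Section compactification.

Lemma duplicate_locally_compact : locally_compact [set: duplicate].
Proof.
move=> x _; rewrite withinET; exists (W None x.1 x.2).
  by apply/nbhs_duplicateP; exists None.
split; first exact: W_compact.
by apply: compact_closed; [exact: duplicate_hausdorff|exact: W_compact].
Qed.

Lemma compact_duplicate_compact : compact [set: compact_duplicate].
Proof. exact: one_point_compactification_compact. Qed.

Lemma compact_duplicate_hausdorff : hausdorff_space compact_duplicate.
Proof.
apply: one_point_compactification_hausdorff.
  exact: duplicate_locally_compact.
exact: duplicate_hausdorff.
Qed.

Definition W_image r t i : set compact_duplicate := Some @` W r t i.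

Lemma W_image_open r t i : lam_lt0 r t -> open (W_image r t i).
Proof. by move=> rt; apply: one_point_compactification_open_some; exact: W_open. Qed.

Lemma W_image_clopen r t i : lam_lt0 r t -> clopen (W_image r t i).
Proof.
move=> rt; split; first exact: W_image_open.
apply: compact_closed; first exact: compact_duplicate_hausdorff.
apply: continuous_compact; last exact: W_compact.
by apply: continuous_subspaceT; exact: one_point_compactification_some_continuous.
Qed.

Lemma compact_duplicate_zero_dimensional : zero_dimensional compact_duplicate.
Proof.
have sep (t : Lambda) i (y : compact_duplicate) : y <> Some (t, i) ->
    exists U : set compact_duplicate, [/\ clopen U, U (Some (t, i)) & ~ U y].
  case: y => [y|] yx.
    have [r [r' [rt r'y W0]]] : exists r r', [/\ lam_lt0 r t, lam_lt0 r' y.1 &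
        W r t i `&` W r' y.1 y.2 = set0].
      by apply: (@W_separate (t, i)) => tiy; apply: yx; rewrite tiy.
    exists (W_image r t i); split; [exact: W_image_clopen|by exists (t, i) => //; exact: W_center|].
    move=> [z rz [zy]]; rewrite zy in rz.
    suff : (set0 : set duplicate) y by [].
    by rewrite -W0; split=> //; case: y r'y {yx W0 zy rz} => u j; exact: W_center.
  exists (W_image None t i); split; first exact: W_image_clopen.
    by exists (t, i) => //; exact: W_center.
  by move=> [].
move=> [[t i]|] y /eqP xy; first by apply: sep => yx; apply: xy.
case: y xy => [[t i]|//] xy; have [U [cU Ut Uy]] := sep t i None xy.
by exists (~` U); split=> //; exact: clopenC.
Qed.

(** An initial interval of Lambda below u meets a set in u only, if u has least
    height in it; the point at infinity remains when the set misses D. *)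
Lemma compact_duplicate_isolated (A : set compact_duplicate) :
  A !=set0 -> isolated A !=set0.
Proof.
move=> A0; have [[a [t [i [Ati ta]]]]|NA] :=
    pselect (exists a t i, A (Some (t, i)) /\ dom t = a); last first.
  have Anone x : A x -> x = None.
    by case: x => [[t i]|//] Ati; case: NA; exists (dom t), t, i.
  have AN : A None by case: A0 => x /[dup]/Anone->.
  exists None; split; first exact/mem_set.
  exists setT; first exact: filterT.
  by apply/seteqP; split=> [x [_ /Anone]|_ ->].
have [|_ [u [j [Auj <-]]] umin] := @omega1_ex_min
    [set a | exists t i, A (Some (t, i)) /\ dom t = a]; first by exists a, t, i.
exists (Some (u, j)); split; first exact/mem_set.
exists (W_image None u j).
  apply: open_nbhs_nbhs; split; first exact: W_image_open.
  by exists (u, j) => //; exact: W_center.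
apply/seteqP; split=> [_ [[[s k] /WP[[_ su] kE] <-] Ask]|_ ->]; last first.
  by split=> //; exists (u, j) => //; exact: W_center.
have us : (dom u <= dom s)%O by apply: umin; exists s, k.
have suE : s = u by apply: (lam_le_eq su); apply/eqP; rewrite eq_le us; case: su => ->.
by rewrite kE suE ellxx.
Qed.

Lemma compact_duplicate_scattered : scattered compact_duplicate.
Proof. by move=> U _; exact: compact_duplicate_isolated. Qed.

(** A cover of D by neighbourhoods on which the sequence at the top is at least
    n; a G_delta-diagonal of D. *)
Definition tail_cover (n : nat) : set_system compact_duplicate :=
  [set U | exists q t i, [/\ U = W_image q t i, lam_lt0 q t &
    forall s, lam_lt0 q s -> forall x, (dom s <= x < dom t)%O -> (n <= t x)%N]].

Lemma tail_cover_open n U : tail_cover n U -> open U.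
Proof. by move=> [q [t [i [-> qt _]]]]; exact: W_image_open. Qed.

Lemma tail_cover_notin_infinity n U : tail_cover n U -> ~ U None.
Proof. by move=> [q [t [i [-> _ _]]]] []. Qed.

Lemma tail_cover_covers n x : x <> None -> exists2 U, tail_cover n U & U x.
Proof.
case: x => [[t i]|//] _; have [q qt qn] := lam_tail_gt t n.
exists (W_image q t i); first by exists q, t, i.
by exists (t, i) => //; exact: W_center.
Qed.

(** If s < u both lie in the interval of t, then u (dom s) = t (dom s) >= n:
    members of the n-th cover contain both points only for n up to u (dom s).
    Points over incomparable or equal elements are never in a common member. *)
Lemma tail_cover_separates x y : x <> y -> exists m, forall n U, (m <= n)%N ->
  tail_cover n U -> U x -> U y -> False.
Proof.
have one (s u : Lambda) : (dom s < dom u)%O -> forall n U, ((u (dom s)).+1 <= n)%N ->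
    tail_cover n U -> forall i j, U (Some (s, i)) -> U (Some (u, j)) -> False.
  move=> su n _ un [q [t [k [-> qt qn]]]] i j.
  move=> [_ /[swap] -[->] /WP[[qs [_ st]] _]] [_ /[swap] -[->] /WP[[_ [ut utE]] _]].
  have := qn _ qs (dom s); rewrite lexx/= => /(_ (lt_le_trans su ut)).
  by rewrite utE// leqNgt un.
case: x y => [[s i]|] [[u j]|] xy; first last.
- by [].
- by exists 0%N => n U _ /tail_cover_notin_infinity.
- by exists 0%N => n U _ /tail_cover_notin_infinity + _.
have [su|us|su] := ltgtP (dom s) (dom u).
- by exists (u (dom s)).+1 => n U + UU Us Uu => /(one s u su)/(_ UU); apply; eauto.
- by exists (s (dom u)).+1 => n U + UU Us Uu => /(one u s us)/(_ UU); apply; eauto.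
exists 0%N => n _ _ [q [t [k [-> qt qn]]]].
move=> [_ /[swap] -[->] /WP[[_ st] iE]] [_ /[swap] -[->] /WP[[_ ut] jE]].
have E : s = u.
  by apply: (lam_le_eq _ su); apply: lam_le_common st ut _; rewrite su.
by apply: xy; rewrite iE jE E.
Qed.

Lemma compact_duplicate_star : has_star compact_duplicate.
Proof.
exists tail_cover; split; first exact: tail_cover_open.
move=> x y xy; have [m mP] := tail_cover_separates xy; exists m; split.
  suff [z xyz zN] : exists2 z, [set x; y] z & z <> None.
    have [U UU Uz] := tail_cover_covers m zN.
    by exists z; split=> //; exists U.
  case: x xy {mP} => [x|] xy; first by exists (Some x) => //; left.
  by exists y; [right|exact/nesym].
move=> U UU a b [xya Ua] [xyb Ub].
by case: xya xyb Ua Ub => -> [] -> // Ua Ub; case: (mP _ _ (leqnn m) UU).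
Qed.

End compactification.

(** * Extensions and limits in the tree *)

Section tree.
Local Open Scope order_scope.
Local Open Scope classical_set_scope.

Lemma omega1_succ (a : omega1) : exists2 b, a < b & forall c, (c < b) = (c <= a).
Proof.
have [b ab] : exists b, a < b.
  apply: contrapT => Nb; apply: omega1_uncountable.
  apply: sub_countable (omega1_countable_segment a); apply: subset_card_le => c _.
  by rewrite /= leNgt; apply/negP => ac; apply: Nb; exists c.
have [|z az zmin] := @omega1_ex_min [set b | a < b]; first by exists b.
exists z => // c; apply/idP/idP => [cz|ca]; last exact: le_lt_trans ca az.
by rewrite leNgt; apply/negP => /zmin; rewrite leNgt cz.
Qed.

(** Countable sets of countable ordinals are bounded, as a countable union of
    countable segments is not everything; b is the supremum. *)
Lemma omega1_sup (d : nat -> omega1) : exists b, forall c, c < b <-> exists k, c < d k.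
Proof.
have [b db] : exists b, forall k, d k <= b.
  apply: contrapT => Nb; apply: omega1_uncountable.
  apply: (@sub_countable _ _ _ (\bigcup_k [set c | c <= d k])).
    apply: subset_card_le => c _; apply: contrapT => Nc; apply: Nb; exists c => k.
    by rewrite leNgt; apply/negP => ck; apply: Nc; exists k => //=; exact: ltW.
  by apply: bigcup_countable => // k _; exact: omega1_countable_segment.
have [|z dz zmin] := @omega1_ex_min [set b | forall k, d k <= b]; first by exists b.
exists z => c; split=> [cz|[k ck]]; last exact: lt_le_trans (dz k).
apply: contrapT => Nc; have /zmin : forall k, d k <= c.
  by move=> k; rewrite leNgt; apply/negP => ck; apply: Nc; exists k.
by rewrite leNgt cz.
Qed.

Lemma fresh_value (t : Lambda) (F : seq nat) (n : nat) : exists m,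
  [/\ (n <= m)%N, m \notin F & forall a, a < dom t -> t a <> m].
Proof.
apply: contrapT => Nm; apply: (@lfun_coinf t).
apply: (@sub_finite_set _ _ [set` F ++ iota 0 n]); last exact: finite_seq.
move=> m tm; rewrite /= mem_cat mem_iota add0n /=; apply: contrapT => /negP.
rewrite negb_or -leqNgt => /andP[mF nm]; apply: Nm; exists m; split=> // a ad am.
by apply: tm; exists a.
Qed.

Lemma lam_append (t : Lambda) (m : nat) : (forall a, a < dom t -> t a <> m) ->
  exists u : Lambda, [/\ lam_le t u, forall c, (c < dom u) = (c <= dom t) &
    u (dom t) = m].
Proof.
move=> tm; have [d td dE] := omega1_succ (dom t).
pose f a := if a < dom t then t a else if a == dom t then m else 0%N.
have fE a : a < dom t -> f a = t a by rewrite /f => ->.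
have fm : f (dom t) = m by rewrite /f ltxx eqxx.
have f_out a : d <= a -> f a = 0%N.
  move=> da; rewrite /f ltNge (ltW (lt_le_trans td da))/=.
  by rewrite gt_eqF//; exact: lt_le_trans da.
have cases a : a < d -> a < dom t \/ a = dom t.
  by rewrite dE le_eqVlt => /predU1P[]; [right|left].
have f_inj a b : a < d -> b < d -> f a = f b -> a = b.
  move=> /cases[at'|->] /cases[bt|->]//.
  - by rewrite !fE//; exact: lfun_inj.
  - by rewrite fE// fm => /tm-/(_ at').
  - by rewrite (fE b)// fm => /esym/tm-/(_ bt).
have f_coinf : infinite_set (~` (f @` [set a | a < d])).
  move=> fin; apply: (@lfun_coinf t).
  apply: (@sub_finite_set _ _ ((~` (f @` [set a | a < d])) `|` [set m])).
    move=> n nt; have [->|nm] := eqVneq n m; first by right.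
    left=> -[a /cases[at'|->]]; last by rewrite fm => mn; rewrite mn eqxx in nm.
    by rewrite fE// => an; apply: nt; exists a.
  by rewrite finite_setU; split=> //; exact: finite_set1.
exists (MkLambda f_out f_inj f_coinf); split=> //.
by split=> /=; [exact: ltW|exact: fE].
Qed.

(** The finite set F is a promise to leave its elements out of the range; it keeps
    the complement of the range infinite along a sequence of extensions. *)
Definition avoids (t : Lambda) (F : seq nat) := forall a, a < dom t -> t a \notin F.

Lemma avoidsS t (F G : seq nat) : {subset F <= G} -> avoids t G -> avoids t F.
Proof. by move=> FG tG a /tG; apply: contra; exact: FG. Qed.

Lemma ell1 (s t : Lambda) : lam_lt s t ->
  (forall x, dom s <= x < dom t -> (t (dom s) <= t x)%N) -> ell s t = 1%N.
Proof.
move=> /lam_ltP[_ st] smin; have b1 : beta s t 1 = dom s.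
  by rewrite /beta/=; apply: next_betaE => //; rewrite lexx st.
rewrite ellE /stage; case: ex_minnP => n nE nmin.
apply/eqP; rewrite eqn_leq nmin ?b1//=.
by case: n nE {nmin} => //; rewrite /beta/= gt_eqF.
Qed.

(** Once m is appended, forbidding all smaller integers not yet used makes m the
    minimum of every later extension from that place on. One more integer is
    forbidden at each step to make the complement of the range infinite at the
    limit. *)
Lemma append_record (s : Lambda) (F : seq nat) (m : nat) :
  avoids s F -> m \notin F -> (forall a, a < dom s -> s a <> m) ->
  exists s' F', [/\ [/\ lam_lt s s', forall c, (c < dom s') = (c <= dom s) & s' (dom s) = m],
    avoids s' F', {subset F <= F'}, (exists2 a, a \in F' & a \notin F) &
    forall t, lam_le s' t -> avoids t F' ->
      forall x, dom s <= x < dom t -> (m <= t x)%N].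
Proof.
move=> sF mF sm; have [s' [ss' s'd s'm]] := lam_append sm.
have cases a : a < dom s' -> a < dom s \/ a = dom s.
  by rewrite s'd le_eqVlt => /predU1P[]; [right|left].
have [a [_ aF as']] := fresh_value s' F 0.
(* Besides a fresh integer, forbid all unused integers below m. *)
pose F' := a :: F ++ [seq j <- iota 0 m | `[< forall x, x < dom s -> s x <> j >]].
exists s', F'; split.
- split=> //; apply/lam_ltP; split=> //; by rewrite s'd.
- move=> x xs'; rewrite inE mem_cat mem_filter mem_iota add0n/=.
  have /eqP/negbTE-> := as' x xs'; rewrite /= negb_or.
  have [xs|xs] := cases x xs'; last by rewrite xs s'm (negPf mF)/= ltnn andbF.
  rewrite (proj2 ss' x xs) sF//= negb_and.
  by apply/orP; left; apply/asboolPn => /(_ x xs).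
- by move=> j jF; rewrite inE mem_cat jF orbT.
- by exists a => //; rewrite mem_head.
- move=> t s't tF' x /andP[sx xt]; rewrite leqNgt; apply/negP => txm.
  have := tF' x xt; rewrite inE mem_cat mem_filter mem_iota add0n txm /= andbT => /negP; apply.
  apply/orP; right; apply/orP; right; apply/asboolP => y ys syx.
  have yt : y < dom t.
    by apply: lt_le_trans (proj1 s't); rewrite s'd ltW.
  have tyx : t y = t x.
    by rewrite -syx -(proj2 ss' y ys) (proj2 s't y)// s'd ltW.
  by have := lfun_inj yt xt tyx => yx; rewrite -yx leNgt ys in sx.
Qed.

(** Appending one record m makes dom s the first ordinal that the definition of
    tau s t picks, so ell s t = 1. Appending m1 > m with m a record afterwards
    makes tau s t consist of dom s and its successor, so ell s t = 2. Thus both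
    parities can be imposed on all permitted extensions at once. *)
Lemma parity_extension (b : bool) (s : Lambda) (F : seq nat) : avoids s F ->
  exists s' F', [/\ lam_lt s s', avoids s' F', {subset F <= F'},
    (exists2 a, a \in F' & a \notin F) &
    forall t, lam_le s' t -> avoids t F' -> odd (ell s t) = b].
Proof.
move=> sF; have [m [_ mF sm]] := fresh_value s F 0.
have odd_step (u : Lambda) (G : seq nat) (n : nat) (v : Lambda) (H : seq nat) :
    [/\ lam_lt u v, forall c, (c < dom v) = (c <= dom u) & v (dom u) = n] ->
    (forall t, lam_le v t -> avoids t H ->
      forall x, dom u <= x < dom t -> (n <= t x)%N) ->
    forall t, lam_le v t -> avoids t H -> ell u t = 1%N.
  move=> [uv vd vn] vH t vt tH; apply: ell1; first exact: lam_lt_le_trans vt.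
  by move=> x xt; rewrite (proj2 vt) ?vd// vn; exact: vH xt.
case: b.
  have [s' [F' [ss' s'F' FF' Fa s'P]]] := append_record sF mF sm.
  exists s', F'; split=> //; first by case: ss'.
  by move=> t s't tF'; rewrite (odd_step s F m s' F').
have [m1 [mm1 m1F sm1]] := fresh_value s F m.+1.
have [u [F1 [[su ud um1] uF1 FF1 _ _]]] := append_record sF m1F sm1.
have uF : avoids u F by exact: avoidsS uF1.
have um a : a < dom u -> u a <> m.
  rewrite ud le_eqVlt => /predU1P[->|as']; last by rewrite (proj2 (proj1 su) a as'); exact: sm.
  by rewrite um1 => mE; rewrite mE ltnn in mm1.
have [s' [F' [[us' s'd s'm] s'F' FF' Fa s'P]]] := append_record uF mF um.
exists s', F'; split=> //; first exact: lam_lt_le_trans (lam_lt_le us').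
move=> t s't tF'; have ut : lam_le u t by exact: lam_le_trans (lam_lt_le us') s't.
have tu : t (dom u) = m by rewrite (proj2 s't) ?s'd.
rewrite (@ellD s u t)//; first last.
- move=> x /andP[sx]; rewrite ud => xs; have -> : x = dom s by apply: le_anti; rewrite sx xs.
  by rewrite tu um1 ltnW.
- exact: lam_lt_le.
rewrite (odd_step u F m s' F')// (@ell1 s u)// => x /andP[sx]; rewrite ud => xs.
by have -> : x = dom s by apply: le_anti; rewrite sx xs.
Qed.

(** The promises in the sets F k supply infinitely many integers outside the range
    of the union. *)
Lemma lam_limit (t : nat -> Lambda) (F : nat -> seq nat) :
  (forall k, lam_lt (t k) (t k.+1)) -> (forall k, avoids (t k) (F k)) ->
  (forall k, {subset F k <= F k.+1}) ->
  (forall k, exists2 a, a \in F k.+1 & a \notin F k) ->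
  exists u, [/\ forall k, lam_le (t k) u, forall k, avoids u (F k) &
    forall r, lam_lt0 r u -> exists k0, forall k, (k0 <= k)%N -> lam_lt0 r (t k)].
Proof.
move=> tS tF FS Fa.
have tle j k : (j <= k)%N -> lam_le (t j) (t k).
  elim: k => [|k IH]; first by rewrite leqn0 => /eqP->; exact: lam_le_refl.
  rewrite leq_eqVlt => /predU1P[->|]; first exact: lam_le_refl.
  by rewrite ltnS => /IH jk; exact: lam_le_trans jk (lam_lt_le (tS k)).
have Fle j k : (j <= k)%N -> {subset F j <= F k}.
  elim: k => [|k IH]; first by rewrite leqn0 => /eqP->.
  rewrite leq_eqVlt => /predU1P[->//|]; rewrite ltnS => /IH jk a /jk; exact: FS.
have [d dP] := omega1_sup (fun k => dom (t k)).
pose f a := if pselect (exists k, a < dom (t k)) is left e then t (projT1 (cid e)) a else 0%N.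
have fE k a : a < dom (t k) -> f a = t k a.
  move=> ak; rewrite /f; case: pselect => [e|[]]; last by exists k.
  case: cid => j /= aj; have [jk|/ltnW kj] := leqP j k.
    by rewrite (proj2 (tle j k jk)).
  by rewrite (proj2 (tle k j kj)).
have f_out a : d <= a -> f a = 0%N.
  by rewrite leNgt /f; case: pselect => // e /negP[]; exact/dP.
have f_inj a b : a < d -> b < d -> f a = f b -> a = b.
  move=> /dP[j aj] /dP[k bk].
  have aM := lt_le_trans aj (proj1 (tle j _ (leq_maxl j k))).
  have bM := lt_le_trans bk (proj1 (tle k _ (leq_maxr j k))).
  by rewrite !(fE (maxn j k))//; exact: lfun_inj.
have fF k a : a < d -> f a \notin F k.
  move=> /dP[j aj]; have aM := lt_le_trans aj (proj1 (tle j _ (leq_maxl j k))).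
  rewrite (fE (maxn j k))//; have := tF _ _ aM; apply: contra.
  exact: Fle (leq_maxr _ _) _.
(* The integers newly forbidden at the successive stages are distinct. *)
have f_coinf : infinite_set (~` (f @` [set a | a < d])).
  have Fa' k : exists a, a \in F k.+1 /\ a \notin F k.
    by have [a aF aNF] := Fa k; exists a.
  have [g gP] := choice Fa'.
  apply: (@sub_infinite_set _ (range g)) => [_ [k _ <-] [a /= ad fa]|].
    by have := fF k.+1 a ad; rewrite fa; case: (gP k) => ->.
  have glt j k : (j < k)%N -> g j <> g k.
    move=> jk gjk; have [_] := gP k; rewrite -gjk.
    by case: (gP j) => /(Fle _ _ jk) ->.
  move=> fin; apply: infinite_nat; apply: sub_finite_set (finite_preimage _ fin).
    by move=> k _; exists k.
  move=> j k _ _ gjk; have [jk|kj|//] := ltngtP j k.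
    by case: (glt _ _ jk).
  by case: (glt _ _ kj).
pose u := MkLambda f_out f_inj f_coinf.
have tu k : lam_le (t k) u.
  split=> [|a ak]; last exact: fE.
  rewrite leNgt; apply/negP => /= dk.
  by have /negP := ltxx d; apply; apply/dP; exists k.
exists u; split=> //.
move=> [r|] ru; last by exists 0%N.
have /lam_ltP[ru' /dP[k0 rk0]] : lam_lt r u := ru.
exists k0 => k k0k; have rk := lt_le_trans rk0 (proj1 (tle k0 k k0k)).
by apply/lam_ltP; split=> //; apply: lam_le_common ru' (tu k) (ltW rk).
Qed.

End tree.

(** * The compactification is not Gruenhage *)

Section gruenhage_game.
Local Open Scope order_scope.
Local Open Scope classical_set_scope.

Section rigid.
Variables (Q : Lambda -> Prop) (i : bool) (U : Lambda -> set duplicate).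
Hypothesis Qopp : forall t, Q t -> ~ U t (t, ~~ i).
Hypothesis Qeq : forall s t, Q s -> Q t -> U t (s, i) -> U s = U t.

(** The choice of an extension after which t can lie in Q only if U t contains no
    W r t i with r < t0. If Q is avoidable above t0, avoid it. Otherwise take s
    in Q and impose even parity on it, so that later t in Q with a neighbourhood
    below s have U t = U s. If some later s' in Q has U s' <> U s, even parity on
    s' is contradictory; if none has, U s' = U s and odd parity on s' puts
    (s', -i) in U t = U s'. *)
Lemma escape_step (t0 : Lambda) (F0 : seq nat) : avoids t0 F0 ->
  exists t1 F1, [/\ lam_lt t0 t1, avoids t1 F1, {subset F0 <= F1},
    (exists2 a, a \in F1 & a \notin F0) &
    forall t, lam_le t1 t -> avoids t F1 -> Q t ->
      forall r, lam_lt0 r t0 -> ~ W r t i `<=` U t].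
Proof.
move=> tF0.
have [[s [Qs t0s sF0]]|Ns] := pselect (exists s, [/\ Q s, lam_le t0 s & avoids s F0]);
    last first.
  have [t1 [F1 [t01 tF1 F01 Fa _]]] := parity_extension true tF0.
  exists t1, F1; split=> // t t1t tF Qt; exfalso; apply: Ns; exists t; split=> //.
    exact: lam_le_trans (lam_lt_le t01) t1t.
  exact: avoidsS tF.
have [s2 [F2 [ss2 sF2 F02 [a aF2 aF0] s2P]]] := parity_extension false sF0.
have W_s b r t u : lam_lt0 r t0 -> lam_le t0 u -> lam_le u t -> odd (ell u t) = b ->
    W r t i (u, b (+) i).
  move=> rt0 t0u ut ub; apply/WP; rewrite ub; split=> //.
  by split=> //; exact: lam_lt0_le_trans t0u.
have t0s2 : lam_lt t0 s2 by exact: lam_le_lt_trans ss2.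
have s_eq t r : lam_le s2 t -> avoids t F2 -> Q t -> lam_lt0 r t0 ->
    W r t i `<=` U t -> U s = U t.
  move=> s2t tF2 Qt rt0 WU; apply: Qeq => //; apply: WU.
  apply: (W_s false) => //; last exact: s2P.
  exact: lam_le_trans (lam_lt_le ss2) s2t.
have [[s' [Qs' s2s' s'F2]]|Ns'] :=
    pselect (exists s', [/\ Q s', lam_le s2 s' & avoids s' F2]); last first.
  exists s2, F2; split=> //; first by exists a.
  by move=> t s2t tF Qt; exfalso; apply: Ns'; exists t.
have t0s' : lam_le t0 s' by exact: lam_le_trans (lam_lt_le t0s2) s2s'.
have main (b : bool) : (b -> U s' = U s) -> (~~ b -> U s' <> U s) -> exists t1 F1,
    [/\ lam_lt t0 t1, avoids t1 F1, {subset F0 <= F1},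
    (exists2 a, a \in F1 & a \notin F0) &
    forall t, lam_le t1 t -> avoids t F1 -> Q t ->
      forall r, lam_lt0 r t0 -> ~ W r t i `<=` U t].
  move=> bT bF; have [t1 [F1 [s't1 tF1 F21 _ t1P]]] := parity_extension b s'F2.
  exists t1, F1; split=> //.
  - exact: lam_le_lt_trans s't1.
  - by move=> j /F02/F21.
  - by exists a => //; exact: F21.
  move=> t t1t tF Qt r rt0 WU.
  have s't : lam_le s' t by exact: lam_le_trans (lam_lt_le s't1) t1t.
  have s't_in := WU _ (W_s b _ _ _ rt0 t0s' s't (t1P t t1t tF)).
  have sE : U s = U t.
    apply: (s_eq t r) => //; first exact: lam_le_trans s't.
    exact: avoidsS tF.
  case: b {t1P} bT bF s't_in => bT bF; last first.
    by move=> /Qeq s'E; apply: bF => //; rewrite s'E.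
  by rewrite -sE -bT//; exact: Qopp.
have [e|ne] := pselect (U s' = U s); first exact: (main true).
exact: (main false).
Qed.

End rigid.

(** The Baire category argument: each index is treated at infinitely many stages,
    and the limit u lies in some Q n with a neighbourhood W r u (i n) inside
    U n u, where r lies below all late stages. *)
Lemma no_countable_rigid_separation (I : countType) (Q : I -> Lambda -> Prop)
    (i : I -> bool) (U : I -> Lambda -> set duplicate) :
  (forall t, exists n, Q n t) ->
  (forall n t, Q n t -> [/\ open (U n t), U n t (t, i n) & ~ U n t (t, ~~ i n)]) ->
  (forall n s t, Q n s -> Q n t -> U n t (s, i n) -> U n s = U n t) -> False.
Proof.
move=> Qcov QU Qeq.
pose idx k : option I := unpickle (logn 2 k.+1).
pose state := {p : Lambda * seq nat | `[< avoids p.1 p.2 >]}.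
pose next k (p q : state) := [/\ lam_lt (val p).1 (val q).1,
  {subset (val p).2 <= (val q).2},
  exists2 a, a \in (val q).2 & a \notin (val p).2 &
  forall n, idx k = Some n -> forall t, lam_le (val q).1 t -> avoids t (val q).2 ->
    Q n t -> forall r, lam_lt0 r (val p).1 -> ~ W r t (i n) `<=` U n t].
have step (kp : nat * state) : exists q, next kp.1 kp.2 q.
  case: kp => k [[t0 F0] /= tF0']; have tF0 := asboolW tF0'.
  have [t1 [F1 [t01 tF1 F01 Fa t1P]]] : exists t1 F1, [/\ lam_lt t0 t1, avoids t1 F1,
      {subset F0 <= F1}, (exists2 a, a \in F1 & a \notin F0) &
      forall n, idx k = Some n -> forall t, lam_le t1 t -> avoids t F1 ->
        Q n t -> forall r, lam_lt0 r t0 -> ~ W r t (i n) `<=` U n t].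
    case: (idx k) => [n|]; last first.
      have [t1 [F1 [t01 tF1 F01 Fa _]]] := parity_extension true tF0.
      by exists t1, F1.
    have Qopp t : Q n t -> ~ U n t (t, ~~ i n) by case/QU.
    have [t1 [F1 [t01 tF1 F01 Fa t1P]]] := escape_step Qopp (@Qeq n) tF0.
    by exists t1, F1; split=> // m [<-].
  have tF1' : `[< avoids (t1, F1).1 (t1, F1).2 >] by apply/asboolP.
  by exists (exist _ (t1, F1) tF1').
have [nxt nxtP] := choice step.
pose e0 : Lambda * seq nat := (lam_empty, nil).
have tF00 : `[< avoids e0.1 e0.2 >] by apply/asboolP => a ad; rewrite in_nil.
pose p0 : state := exist _ e0 tF00.
pose p := fix p k : state := if k is k'.+1 then nxt (k', p k') else p0.
have pP k : next k (p k) (p k.+1) by exact: (nxtP (k, p k)).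
have pav k : avoids (val (p k)).1 (val (p k)).2 by case: (p k) => q /= /asboolP.
have [||||u [pu uF ulim]] := @lam_limit (fun k => (val (p k)).1) (fun k => (val (p k)).2).
- by move=> k; case: (pP k).
- exact: pav.
- by move=> k; case: (pP k).
- by move=> k; case: (pP k).
have [n Qn] := Qcov u; have [oU Uu _] := QU _ _ Qn.
have [r ru rU] : exists2 r, lam_lt0 r u & W r u (i n) `<=` U n u.
  by apply/(@nbhs_duplicateP (u, i n)); exact: open_nbhs_nbhs.
have [k0 k0P] := ulim r ru.
(* A stage past k0 at which the 2-adic valuation of k.+1 encodes n. *)
pose k := (2 ^ pickle n * (2 * k0).+1).-1.
have kS : k.+1 = (2 ^ pickle n * (2 * k0).+1)%N.
  by rewrite /k prednK// muln_gt0 expn_gt0.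
have k0k : (k0 <= k)%N.
  rewrite -ltnS kS; apply: (@leq_trans (2 * k0).+1).
    by rewrite ltnS mul2n -addnn leq_addr.
  by rewrite leq_pmull// expn_gt0.
have idxk : idx k = Some n.
  rewrite /idx kS lognM ?expn_gt0// pfactorK// lognE /= dvdn2 /= oddM /= addn0.
  by rewrite pickleK.
have [_ _ _ kP] := pP k.
exact: (kP n idxk u (pu _) (uF _) Qn r (k0P k k0k)).
Qed.

(** Separating (t, true) from (t, false) by U in a family U_ n, either the point of
    the pair in U lies in the common intersection of the family, which is then
    one open witness for all such t; or it lies outside, and then two distinct
    members of the family cannot share it, so that it determines U. *)
Lemma compact_duplicate_not_gruenhage : ~ gruenhage compact_duplicate.
Proof.
move=> [U_ [R_ [Uo Usep UR]]].
(* For at least two members, core n is the common pairwise intersection R_ n. *)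
pose core n : set compact_duplicate := \bigcap_(V in U_ n) V.
have Ucore n V V' x : U_ n V -> U_ n V' -> V <> V' -> V x -> V' x -> core n x.
  move=> UV UV' VV' Vx V'x X UX; have [<-//|VX] := pselect (V = X).
  suff : (V `&` X) x by case.
  by rewrite (UR n V X)// -(UR n V V').
have core_open n V : U_ n V -> open (core n).
  move=> UV; have [[V' [UV' VV']]|N] := pselect (exists V', U_ n V' /\ V <> V').
    suff -> : core n = V `&` V' by apply: openI; [exact: Uo UV|exact: Uo UV'].
    apply/seteqP; split=> [x cx|x [Vx V'x]]; last exact: (Ucore n V V').
    by split; exact: cx.
  suff -> : core n = V by exact: Uo UV.
  apply/seteqP; split=> [x|x Vx X UX]; first exact.
  by have [<-//|VX] := pselect (V = X); case: N; exists X.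
pose pt t i : compact_duplicate := Some (t, i).
pose sep n i t V := [/\ U_ n V, V (pt t i), ~ core n (pt t i) & ~ V (pt t (~~ i))].
pose Q (c : nat * bool * bool) t := if c.1.2
  then [/\ U_ c.1.1 !=set0, core c.1.1 (pt t c.2) & ~ core c.1.1 (pt t (~~ c.2))]
  else exists V, sep c.1.1 c.2 t V.
pose wit (c : nat * bool * bool) t := if c.1.2 then core c.1.1
  else xget set0 (sep c.1.1 c.2 t).
have witP n i t : Q (n, false, i) t -> sep n i t (wit (n, false, i) t).
  by move=> [V VP]; rewrite /wit/=; case: xgetP => [X _ //|/(_ V)].
apply: (@no_countable_rigid_separation _ Q (fun c => c.2)
  (fun c t => Some @^-1` wit c t)).
- move=> t; have [|n [V UV [z zE]]] := Usep (pt t true) (pt t false); first by [].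
  have [i [Vi NVi]] : exists i, V (pt t i) /\ ~ V (pt t (~~ i)).
    have [zt zV] : ([set pt t true; pt t false] `&` V) z by rewrite zE.
    case: zt zV => zt Vz; [exists true|exists false]; rewrite -/(pt t _) -zt; split=> // Vo.
      suff : [set z] (pt t false) by rewrite zt.
      by rewrite -zE; split=> //; right.
    suff : [set z] (pt t true) by rewrite zt.
    by rewrite -zE; split=> //; left.
  have [ci|Nci] := pselect (core n (pt t i)).
    exists (n, true, i); split=> //=; first by exists V.
    by move=> /(_ V UV).
  by exists (n, false, i), V.
- move=> [[n [|]] i] t.
    move=> [/= [V UV] ci Nci]; split=> //; rewrite /wit/=.
    apply: open_comp (core_open n V UV) => x _.
    exact: one_point_compactification_some_continuous.
  move=> /witP[UV Vi _ NVi]; split=> //.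
  apply: open_comp (Uo n _ UV) => x _.
  exact: one_point_compactification_some_continuous.
- move=> [[n [|]] i] s t //.
  move=> /witP[Us si Nsi _] /witP[Ut _ _ _] /= tsi; congr (Some @^-1` _).
  apply: contrapT => st; apply: Nsi; exact: (Ucore n _ _ _ Us Ut st).
Qed.

End gruenhage_game.

(** * Continuous functions and clopen sets *)

Section cutoff.
Variables (R : realType) (K : topologicalType).
Implicit Types (f g : Cspace K R) (U V : set K).

Lemma C_addE f g x : (f + g) x = f x + g x :> R. Proof. by []. Qed.
Lemma C_oppE f x : (- f) x = - f x :> R. Proof. by []. Qed.
Lemma C_subE f g x : (f - g) x = f x - g x :> R. Proof. by []. Qed.
Lemma C_scaleE (a : R) f x : (a *: f) x = a * f x :> R. Proof. by []. Qed.
Lemma C_zeroE x : (0 : Cspace K R) x = 0 :> R. Proof. by []. Qed.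

Lemma C_sumE (I : Type) (r : seq I) (F : I -> Cspace K R) x :
  (\sum_(i <- r) F i) x = \sum_(i <- r) F i x :> R.
Proof. by elim/big_rec2: _ => // i y g _ <-. Qed.

Lemma C_eq f g : f =1 g -> f = g.
Proof. by move/continuousEP. Qed.

Lemma indic_if U x : \1_U x = if `[< U x >] then 1 else 0 :> R.
Proof. by rewrite indicE; case: asboolP => xU; [rewrite mem_set|rewrite memNset]. Qed.

Lemma indic_in U x : U x -> \1_U x = 1 :> R.
Proof. by move=> xU; rewrite indicE mem_set. Qed.

Lemma indic_out U x : ~ U x -> \1_U x = 0 :> R.
Proof. by move=> xU; rewrite indicE memNset. Qed.

Lemma indic_ge0 U x : 0 <= \1_U x :> R.
Proof. by rewrite indic_if ; case: ifP. Qed.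

Lemma indic_le1 U x : \1_U x <= 1 :> R.
Proof. by rewrite indic_if ; case: ifP. Qed.

Lemma indic_le U V x : U `<=` V -> \1_U x <= \1_V x :> R.
Proof.
by move=> UV; have [/[dup]/UV Vx Ux|Ux] := pselect (U x);
  rewrite ?(indic_in Ux) ?(indic_in Vx)// (indic_out Ux) indic_ge0.
Qed.

Lemma cutoff_exists V f : clopen V ->
  exists g, forall x, g x = (\1_V x : R) * f x.
Proof.
move=> [oV cV].
have cts : continuous ((fun x => (\1_V x : R) * f x) : K -> R^o).
  move=> x; rewrite /continuous_at; have [Vx|Vx] := pselect (V x).
    have VV : nbhs x V by apply: open_nbhs_nbhs.
    rewrite indic_in// mul1r => A Afx.
    apply: filterS2 VV (@cts_fun _ _ f x A Afx) => y Vy /=.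
    by rewrite indic_in// mul1r.
  have VV : nbhs x (~` V) by apply: open_nbhs_nbhs; split=> //; exact: closed_openC.
  rewrite indic_out// mul0r => A A0; apply: filterS VV => y Vy /=.
  by rewrite indic_out// mul0r; exact: nbhs_singleton A0.
by exists (mkcts cts : Cspace K R).
Qed.

(** The product of f with the indicator of V, made total so that it can be
    composed freely. *)
Definition cutoff V f : Cspace K R :=
  if pselect (clopen V) is left cV then projT1 (cid (cutoff_exists f cV)) else 0.

Lemma cutoffE V f x : clopen V -> cutoff V f x = (\1_V x : R) * f x.
Proof. by rewrite /cutoff; case: pselect => // cV _; case: cid. Qed.

Lemma C_one_cts : continuous ((fun=> 1) : K -> R^o).
Proof. by move=> x; exact: cvg_cst. Qed.

Definition C_one : Cspace K R := mkcts C_one_cts.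

(** One inequality says both that |f| <= 1 and that f vanishes off U. *)
Definition uball U : set (Cspace K R) := [set f | forall x, `|f x : R| <= \1_U x].

Lemma uball0 U : uball U 0.
Proof. by move=> x; rewrite C_zeroE normr0 indic_ge0. Qed.

Lemma uballN U f : uball U f -> uball U (- f).
Proof. by move=> fU x; rewrite C_oppE normrN. Qed.

Lemma uball_le1 U f x : uball U f -> `|f x : R| <= 1.
Proof. by move=> /(_ x)/le_trans; apply; exact: indic_le1. Qed.

Lemma uball_out U f x : uball U f -> ~ U x -> f x = 0.
Proof. by move=> /(_ x) + Ux; rewrite indic_out// normr_le0 => /eqP. Qed.

Lemma uballP U f : uball U f <->
  (forall x, `|f x : R| <= 1) /\ (forall x, ~ U x -> f x = 0).
Proof.
split=> [fU|[f1 f0] x].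
  by split=> x => [|Ux]; [exact: uball_le1 fU|exact: uball_out fU Ux].
have [Ux|Ux] := pselect (U x); first by rewrite indic_in.
by rewrite f0// normr0 indic_ge0.
Qed.

Lemma uballS U V : U `<=` V -> uball U `<=` uball V.
Proof. by move=> UV f fU x; apply: le_trans (fU x) _; exact: indic_le. Qed.

Lemma uball_cutoff U V f : clopen V -> uball U f -> uball (V `&` U) (cutoff V f).
Proof.
move=> cV fU x; rewrite cutoffE// normrM ger0_norm ?indic_ge0//.
have [Vx|Vx] := pselect (V x); last by rewrite indic_out ?mul0r ?indic_ge0.
rewrite indic_in// mul1r; apply: le_trans (fU x) _; rewrite !indic_if.
by have -> : `[<(V `&` U) x>] = `[<U x>] by apply: asbool_equiv_eq; split=> [[]|].
Qed.

Lemma uball_indic V : clopen V -> uball V (cutoff V C_one).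
Proof.
move=> cV x; rewrite cutoffE// normrM ger0_norm ?indic_ge0//.
by rewrite /= normr1 mulr1.
Qed.

Lemma uball_add U V f g : uball U f -> uball V g -> U `&` V = set0 ->
  uball (U `|` V) (f + g).
Proof.
move=> fU gV UV x; rewrite C_addE.
have [Ux|Ux] := pselect (U x).
  have Vx : ~ V x by move=> Vx; have : (U `&` V) x by []; rewrite UV.
  by rewrite (uball_out gV)// addr0 indic_in ?(uball_le1 _ fU)//; left.
rewrite (uball_out fU)// add0r; apply: le_trans (gV x) _.
by apply: indic_le; right.
Qed.

Lemma cutoff_split V f : clopen V -> f = cutoff V f + cutoff (~` V) f.
Proof.
move=> cV; apply: C_eq => x; rewrite C_addE !cutoffE//; last exact: clopenC.
have [Vx|Vx] := pselect (V x).
  by rewrite indic_in// indic_out ?mul1r ?mul0r ?addr0//; apply.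
by rewrite indic_out// indic_in ?mul1r ?mul0r ?add0r.
Qed.

End cutoff.
Arguments C_one {R K}.
Arguments uball R {K} U.

(** * Variation and point masses of a functional *)

Section functional.
Variables (R : realType) (K : topologicalType).
Hypothesis Kclopen : forall (x : K) (U : set K), nbhs x U ->
  exists V, [/\ clopen V, V x & V `<=` U].
Implicit Types (f g : Cspace K R) (U V : set K) (phi : Cspace K R -> R^o).

(** Boundedness for the sup norm, stated with upper bounds M in place of suprema. *)
Definition sup_bounded phi : Prop :=
  linear phi /\ exists2 C : R, 0 <= C & forall f M,
    (forall x, `|f x : R| <= M) -> `|phi f : R| <= C * M.

(** |phi|(U), for the variation |phi| of the measure phi, when U is open. *)
Definition mass phi U : R := sup [set (phi f : R) | f in uball R U].

(** The restriction of phi - c delta_x to small neighbourhoods V of x has small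
    variation; so c = phi({x}) for the measure phi. *)
Definition is_atom phi (x : K) (c : R) : Prop := forall e : R, 0 < e ->
  exists V, [/\ clopen V, V x & forall f, uball R V f -> `|(phi f : R) - c * f x| <= e].

Definition mu phi (x : K) : R := xget 0 [set c | is_atom phi x c].

Section one.
Variable phi : Cspace K R -> R^o.
Hypothesis sphi : sup_bounded phi.

Let lphi : linear phi. Proof. by case: sphi. Qed.

Lemma lin0 : phi 0 = 0 :> R.
Proof. by have := lphi (-1) 0 0; rewrite scaler0 addr0 scaleN1r addNr. Qed.

Lemma linD f g : phi (f + g) = phi f + phi g :> R.
Proof. by have := lphi 1 f g; rewrite !scale1r. Qed.

Lemma linZ (a : R) f : phi (a *: f) = a * phi f :> R.
Proof. by have := lphi a f 0; rewrite lin0 !addr0. Qed.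

Lemma linN f : phi (- f) = - phi f :> R.
Proof. by rewrite -scaleN1r linZ mulN1r. Qed.

Lemma linB f g : phi (f - g) = phi f - phi g :> R.
Proof. by rewrite linD linN. Qed.

Lemma lin_sum (I : Type) (r : seq I) (F : I -> Cspace K R) :
  phi (\sum_(i <- r) F i) = \sum_(i <- r) phi (F i) :> R.
Proof.
by elim/big_rec2: _ => [|i y g _ <-]; rewrite ?lin0// linD.
Qed.

Lemma has_ub_mass U : has_ubound [set (phi f : R) | f in uball R U].
Proof.
have [C C0 phiC] := sphi.2; exists C => _ [f fU <-].
rewrite -[C]mulr1; apply: le_trans (ler_norm _) _; apply: phiC => x.
exact: uball_le1 fU.
Qed.

Lemma le_mass U f : uball R U f -> (phi f : R) <= mass phi U.
Proof. by move=> fU; apply: ub_le_sup; [exact: has_ub_mass|exists f]. Qed.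

Lemma mass_le U (c : R) : (forall f, uball R U f -> (phi f : R) <= c) -> mass phi U <= c.
Proof.
move=> Uc; apply: ge_sup; first by exists (phi 0), 0 => //; exact: uball0.
by move=> _ [f fU <-]; exact: Uc.
Qed.

Lemma mass_ge0 U : 0 <= mass phi U.
Proof. by rewrite -lin0 le_mass//; exact: uball0. Qed.

Lemma mass_mono U V : U `<=` V -> mass phi U <= mass phi V.
Proof. by move=> UV; apply: mass_le => f fU; apply: le_mass; exact: uballS fU. Qed.

(** A function on U \ V can be added to any function on V without leaving the unit
    ball. *)
Lemma mass_superadd U V f : V `<=` U -> uball R (U `\` V) f ->
  `|phi f : R| <= mass phi U - mass phi V.
Proof.
move=> VU.
suff suf g : uball R (U `\` V) g -> (phi g : R) <= mass phi U - mass phi V.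
  by move=> fUV; rewrite ler_norml lerNl -linN !suf//; exact: uballN.
move=> gUV; rewrite lerBrDr -lerBrDl; apply: mass_le => h hV.
rewrite lerBrDl -linD; apply: le_mass.
have -> : U = (U `\` V) `|` V by rewrite setUC setDUK.
by apply: uball_add => //; rewrite setIC setDIK.
Qed.

(** Choose V with |phi|(V) within e / 2 of the infimum over the neighbourhoods of
    x: removing a smaller neighbourhood then leaves variation at most e / 2, and
    on the smaller one f is uniformly small. *)
Lemma mass_punctured (x : K) (e : R) : 0 < e -> exists V, [/\ clopen V, V x &
  forall f, uball R V f -> f x = 0 -> `|phi f : R| <= e].
Proof.
move=> e0; have e20 : 0 < e / 2 by rewrite divr_gt0.
pose E := [set mass phi V | V in [set V | clopen V /\ V x]].
have E0 : E !=set0 by exists (mass phi setT), setT => //; split=> //; exact: clopenT.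
have Elb : has_lbound E by exists 0 => _ [V _ <-]; exact: mass_ge0.
have [_ [V [cV Vx] <-] Vinf] := inf_adherent e20 (conj E0 Elb).
exists V; split=> // f fV fx0.
have [C C0 phiC] := sphi.2.
have C10 : 0 < C + 1 by rewrite ltr_wpDl.
pose d := e / 2 / (C + 1).
have d0 : 0 < d by rewrite divr_gt0.
have [V1 [cV1 V1x V1f]] : exists V1, [/\ clopen V1, V1 x &
    V1 `<=` [set y | `|f y| < d]].
  apply: Kclopen; have /cvgr_norm_lt := @cts_fun _ _ f x.
  by apply; rewrite fx0 normr0.
pose V2 := V `&` V1.
have cV2 : clopen V2 by exact: clopenI.
have phi1 : `|phi (cutoff V2 f) : R| <= e / 2.
  have -> : e / 2 = (C + 1) * d by rewrite /d mulrCA divff ?mulr1// gt_eqF.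
  apply: (@le_trans _ _ (C * d)); last by rewrite ler_pM2r// lerDl.
  apply: phiC => y; rewrite cutoffE//.
  have [V2y|V2y] := pselect (V2 y).
    by rewrite indic_in// mul1r ltW//; exact: V1f V2y.2.
  by rewrite indic_out// mul0r normr0 ltW.
have phi2 : `|phi (cutoff (~` V2) f) : R| <= e / 2.
  have := @mass_superadd V V2 (cutoff (~` V2) f) (@subIsetl _ _ _).
  have -> : V `\` V2 = ~` V2 `&` V by rewrite setIC.
  move=> /(_ (uball_cutoff (clopenC V cV2) fV)) /le_trans; apply.
  rewrite lerBlDl; apply: (le_trans (ltW Vinf)); rewrite lerD2r.
  by apply: inf_lbound => //; exists V2.
rewrite (cutoff_split f cV2) linD; apply: le_trans (ler_normD _ _) _.
by rewrite [e]splitr lerD.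
Qed.

Let near_atom (x : K) (c e : R) := exists V, [/\ clopen V, V x &
  forall f, uball R V f -> `|(phi f : R) - c * f x| <= e].

Let near_atom_exists (x : K) (e : R) : 0 < e -> exists c, near_atom x c e.
Proof.
move=> e0; have e20 : 0 < e / 2 by rewrite divr_gt0.
have [V [cV Vx Vphi]] := mass_punctured x e20.
exists (phi (cutoff V C_one)), V; split=> // f fV.
(* The factor 1/2 brings f - f x * 1_V, which is bounded by 2, into the ball. *)
pose g : Cspace K R := 2^-1 *: (f - f x *: cutoff V C_one).
have -> : phi f - phi (cutoff V C_one) * f x = 2 * phi g.
  by rewrite linZ linB linZ mulrA divff ?pnatr_eq0// mul1r [f x * _]mulrC.
rewrite normrM ger0_norm// mulrC -ler_pdivlMr//; apply: Vphi.
- apply/uballP; split=> [y|y Vy].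
    rewrite C_scaleE C_subE C_scaleE cutoffE//= mulr1 normrM ger0_norm// ler_pdivrMl// mulr1.
    apply: le_trans (ler_normB _ _) _; rewrite [2]/(1 + 1) lerD ?(uball_le1 _ fV)//.
    rewrite normrM -[leRHS]mulr1 ler_pM ?(uball_le1 _ fV)//.
    by rewrite ger0_norm ?indic_ge0// indic_le1.
  rewrite C_scaleE C_subE C_scaleE cutoffE// indic_out// (uball_out fV)//.
  by rewrite mul0r mulr0 subr0 mulr0.
- by rewrite C_scaleE C_subE C_scaleE cutoffE// indic_in//= !mulr1 subrr mulr0.
Qed.

Let near_atom_close (x : K) (c d e e' : R) :
  near_atom x c e -> near_atom x d e' -> c - e <= d + e'.
Proof.
move=> [V [cV Vx Vphi]] [U [cU Ux Uphi]].
have cVU : clopen (V `&` U) by exact: clopenI.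
have g1 : uball R (V `&` U) (cutoff (V `&` U) C_one) by exact: uball_indic.
have := Uphi _ (uballS (@subIsetr _ _ _) g1).
have := Vphi _ (uballS (@subIsetl _ _ _) g1).
rewrite !cutoffE// indic_in//= !mulr1 !ler_norml; lra.
Qed.

(** The approximate values c with error e form intersecting intervals [c - e, c + e],
    by comparison on a common neighbourhood; the mass is the supremum of their
    left ends. *)
Lemma atom_exists (x : K) : exists c, is_atom phi x c.
Proof.
pose S : set R := [set s | exists c e, [/\ 0 < e, near_atom x c e & s = c - e]].
have S0 : S !=set0.
  by have [c cP] := @near_atom_exists x 1 ltr01; exists (c - 1), c, 1.
have Sub c e : near_atom x c e -> ubound S (c + e).
  by move=> cP _ [d [e' [_ dP ->]]]; exact: near_atom_close dP cP.
exists (sup S) => e e0; have e20 : 0 < e / 2 by rewrite divr_gt0.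
have [c cP] := near_atom_exists x e20.
have cS : `|sup S - c| <= e / 2.
  rewrite ler_distl; apply/andP; split.
    by apply: ub_le_sup; [exists (c + e / 2); exact: Sub|exists c, (e / 2)].
  by apply: ge_sup => //; exact: Sub.
have [V [cV Vx Vphi]] := cP; exists V; split=> // f fV.
have -> : phi f - sup S * f x = (phi f - c * f x) - (sup S - c) * f x by ring.
apply: le_trans (ler_normB _ _) _; rewrite [leRHS]splitr lerD ?Vphi//.
rewrite normrM -[leRHS]mulr1 ler_pM//; exact: uball_le1 fV.
Qed.

Lemma atom_uniq (x : K) (c d : R) : is_atom phi x c -> is_atom phi x d -> c = d.
Proof.
suff le12 (a b : R) : is_atom phi x a -> is_atom phi x b -> a <= b.
  by move=> cP dP; apply/eqP; rewrite eq_le !le12.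
move=> aP bP; apply/ler_addgt0Pr => e e0; have e20 : 0 < e / 2 by rewrite divr_gt0.
have := near_atom_close (aP _ e20) (bP _ e20); lra.
Qed.

Lemma muP x : is_atom phi x (mu phi x).
Proof. by rewrite /mu; have [c cP] := atom_exists x; case: xgetP => [d _ //|/(_ c)]. Qed.

Lemma mu_atom x c : is_atom phi x c -> mu phi x = c.
Proof. exact/atom_uniq/muP. Qed.

End one.
End functional.

(** * Functionals on a scattered space are atomic *)

Section atomic.
Variables (R : realType) (K : topologicalType).
Hypothesis Kclopen : forall (x : K) (U : set K), nbhs x U ->
  exists V, [/\ clopen V, V x & V `<=` U].
Hypothesis Khaus : hausdorff_space K.
Hypothesis Kcompact : compact [set: K].
Hypothesis Kscat : forall A : set K, A !=set0 -> isolated A !=set0.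
Implicit Types (f g : Cspace K R) (U V : set K) (phi : Cspace K R -> R^o).

Section one.
Variable phi : Cspace K R -> R^o.
Hypothesis sphi : sup_bounded phi.

Let concentrated U := forall e : R, 0 < e -> exists F : seq K,
  [/\ uniq F, forall x, x \in F -> U x & forall f, uball R U f ->
    `|(phi f : R) - \sum_(x <- F) mu phi x * f x| <= e].

Let concentratedS U V : V `<=` U -> concentrated U -> concentrated V.
Proof.
move=> VU cU e e0; have [F [uF FU Fphi]] := cU e e0.
exists [seq x <- F | `[< V x >]]; split.
- exact: filter_uniq.
- by move=> x; rewrite mem_filter => /andP[/asboolP].
- move=> f fV; rewrite big_filter; have := Fphi f (uballS VU fV).
  rewrite (bigID (fun x => `[< V x >]))/= [X in phi f - (_ + X)]big1 ?addr0// => x.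
  by move=> /asboolPn Vx; rewrite (uball_out fV)// mulr0.
Qed.

Let concentratedU U V : clopen U -> concentrated U -> concentrated V ->
  concentrated (U `|` V).
Proof.
move=> cU UP VP e e0; have e20 : 0 < e / 2 by rewrite divr_gt0.
have [F [uF FU Fphi]] := UP _ e20.
have [G [uG GV Gphi]] := concentratedS (@subDsetl _ V U) VP e20.
exists (F ++ G); split.
- rewrite cat_uniq uF uG andbT; apply/hasPn => x /GV[_ Ux]; apply/negP => xF.
  by apply: Ux; exact: FU.
- by move=> x; rewrite mem_cat => /orP[/FU|/GV[]]; [left|right].
- move=> f fUV; have cU' := clopenC U cU.
  have f1 : uball R U (cutoff U f).
    by apply: uballS (uball_cutoff cU fUV); apply: subIsetl.
  have f2 : uball R (V `\` U) (cutoff (~` U) f).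
    by apply: uballS (uball_cutoff cU' fUV) => x [Ux [|]].
  have F1 : \sum_(x <- F) mu phi x * f x = \sum_(x <- F) mu phi x * cutoff U f x.
    by apply: eq_big_seq => x /FU Ux; rewrite cutoffE// indic_in// mul1r.
  have G1 : \sum_(x <- G) mu phi x * f x =
      \sum_(x <- G) mu phi x * cutoff (~` U) f x.
    by apply: eq_big_seq => x /GV[_ Ux]; rewrite cutoffE// indic_in// mul1r.
  rewrite big_cat/= F1 G1 {1}(cutoff_split f cU) linD// opprD addrACA.
  by apply: le_trans (ler_normD _ _) _; rewrite [leRHS]splitr lerD ?Fphi ?Gphi.
Qed.

Let concentrated0 : concentrated set0.
Proof.
move=> e e0; exists [::]; split=> // f f0.
have -> : f = 0 by apply: C_eq => x; rewrite (uball_out f0).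
by rewrite lin0// big_nil subrr normr0 ltW.
Qed.

Let loc_concentrated x := exists V, [/\ clopen V, V x & concentrated V].

(** Concentration passes to subsets and to finite unions of clopen sets, so
    [compact_ind] applies. *)
Let concentrated_compact A : clopen A -> A `<=` loc_concentrated -> concentrated A.
Proof.
move=> [oA cA] Aloc.
have [||||B [V [cV VP BV]] AB] := @compact_ind K
    (fun U => exists V, [/\ clopen V, concentrated V & U `<=` V]) A.
- by exists set0; split=> //; exact: clopen0.
- move=> B C [V [cV VP BV]] [U [cU UP CU]]; exists (V `|` U); split.
  + exact: clopenU.
  + exact: concentratedU.
  + exact: setUSS.
- exact: subclosed_compact Kcompact _.
- move=> x /Aloc[V [cV Vx VP]]; exists V.
    by apply: open_nbhs_nbhs; split=> //; case: cV.
  by exists V; split.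
- by apply: concentratedS VP; exact: subset_trans BV.
Qed.

(** Near x only the mass at x counts, and the remainder is a compact set of points
    where concentration is known. *)
Let concentrated_point V x : clopen V -> V x -> V `\ x `<=` loc_concentrated -> concentrated V.
Proof.
move=> cV Vx Vloc e e0; have e20 : 0 < e / 2 by rewrite divr_gt0.
have [U [cU Ux Uphi]] := muP Kclopen sphi x e20.
have cUV := clopenI cU cV; have cU' := clopenC U cU.
have VU : concentrated (V `\` U).
  apply: concentrated_compact; first exact: clopenI.
  by move=> y [Vy Uy]; apply: Vloc; split=> // yx; apply: Uy; rewrite yx.
have [F [uF FU Fphi]] := VU _ e20.
exists (x :: F); split.
- by rewrite /= uF andbT; apply/negP => /FU[].
- by move=> y; rewrite inE => /orP[/eqP->//|/FU[]].
- move=> f fV; rewrite big_cons {1}(cutoff_split f cU) linD// opprD addrACA.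
  have -> : f x = cutoff U f x by rewrite cutoffE// indic_in// mul1r.
  have -> : \sum_(y <- F) mu phi y * f y =
      \sum_(y <- F) mu phi y * cutoff (~` U) f y.
    by apply: eq_big_seq => y /FU[_ Uy]; rewrite cutoffE// indic_in// mul1r.
  apply: le_trans (ler_normD _ _) _; rewrite [leRHS]splitr lerD//.
    by apply/Uphi/(uballS _ (uball_cutoff cU fV)); exact: subIsetl.
  by apply/Fphi/(uballS _ (uball_cutoff cU' fV)) => y [].
Qed.

(** The norm limit of finitely supported measures, a form of Rudin's theorem that
    duals of C(K) with K scattered are l1-spaces. A point isolated in the set
    where concentration fails is ruled out by [concentrated_point]. *)
Lemma functional_atomic (e : R) : 0 < e -> exists2 F : seq K, uniq F &
  forall f, uball R setT f -> `|(phi f : R) - \sum_(x <- F) mu phi x * f x| <= e.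
Proof.
move=> e0; have locT x : loc_concentrated x.
  apply: contrapT => Nx; have [|z [/set_mem Nz [U zU Uz]]] := @Kscat (~` loc_concentrated).
    by exists x.
  have [V [cV Vz VU]] := Kclopen zU.
  apply: Nz; exists V; split=> //; apply: concentrated_point (Vz) _ => //.
  move=> y [Vy yz]; apply: contrapT => Ny; apply: yz.
  suff : [set z] y by [].
  by rewrite -Uz; split=> //; exact: VU.
have [F [uF _ Fphi]] := concentrated_compact clopenT (fun x _ => locT x) e0.
by exists F.
Qed.

(** The points of F have disjoint clopen neighbourhoods in U; on each of them take
    the sign of the mass. *)
Lemma sum_mu_le_approx (F : seq K) U (e : R) : uniq F -> open U ->
  (forall x, x \in F -> U x) -> 0 < e -> exists2 f, uball R U f &
  \sum_(x <- F) `|mu phi x| - e <= (phi f : R).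
Proof.
elim: F U e => [|x F IH] U e.
  move=> _ _ _ e0; exists 0; first exact: uball0.
  by rewrite big_nil lin0// sub0r oppr_le0 ltW.
rewrite cons_uniq => /andP[xF uF] oU FU e0; have e20 : 0 < e / 2 by rewrite divr_gt0.
have [W [cW Wx WF]] : exists W, [/\ clopen W, W x & forall y, y \in F -> ~ W y].
  elim: F xF {IH uF FU} => [|y F IH]; first by exists setT; split=> //; exact: clopenT.
  rewrite inE negb_or => /andP[xy /IH[W [cW Wx WF]]].
  have /(_ (~` [set y]))[|V [cV Vx Vy]] := @Kclopen x.
    apply: open_nbhs_nbhs; split; last exact/eqP.
    exact/closed_openC/accessible_closed_set1/hausdorff_accessible.
  exists (V `&` W); split=> //; first exact: clopenI.
  by move=> z; rewrite inE => /orP[/eqP-> [/Vy/(_ erefl)]|/WF Wz []].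
have [V1 [cV1 V1x V1phi]] := muP Kclopen sphi x e20.
have [V2 [cV2 V2x V2U]] : exists V, [/\ clopen V, V x & V `<=` U].
  by apply: Kclopen; apply: open_nbhs_nbhs; split=> //; apply: FU; rewrite mem_head.
pose V := V1 `&` (V2 `&` W).
have cV : clopen V by do 2?apply: clopenI.
have [|y yF|f fUV fphi] := IH (U `\` V) (e / 2) uF _ _ e20.
- by apply: openI => //; apply: closed_openC; case: cV.
- by split; [apply: FU; rewrite inE yF orbT|move=> [_ [_]]; exact: WF].
pose g : Cspace K R := Num.sg (mu phi x) *: cutoff V C_one.
have gV : uball R V g.
  move=> y; apply: (@le_trans _ _ `|cutoff V (C_one : Cspace K R) y : R|).
    by rewrite C_scaleE normrM ler_piMl// normr_sg; case: eqP.
  exact: uball_indic cV y.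
have VU : V `<=` U by move=> y [_ [/V2U]].
exists (f + g).
  have -> : U = (U `\` V) `|` V by rewrite setUC setDUK.
  by apply: uball_add => //; rewrite setIC setDIK.
have := V1phi _ (uballS (@subIsetl _ _ _) gV).
rewrite big_cons linD// C_scaleE cutoffE// indic_in//= !mulr1 [_ * Num.sg _]mulrC -normrEsg.
by rewrite ler_norml => /andP[+ _]; lra.
Qed.

Lemma sum_mu_le_mass (F : seq K) U : uniq F -> open U ->
  (forall x, x \in F -> U x) -> \sum_(x <- F) `|mu phi x| <= mass phi U.
Proof.
move=> uF oU FU; apply/ler_addgt0Pr => e e0.
have [f fU fphi] := sum_mu_le_approx uF oU FU e0.
by rewrite -lerBlDr; apply: le_trans fphi _; exact: le_mass.
Qed.

(** The same finite set F serves all U. *)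
Lemma mass_le_sum_mu (e : R) : 0 < e -> exists2 F : seq K, uniq F &
  forall U, mass phi U <= \sum_(x <- F | `[< U x >]) `|mu phi x| + e.
Proof.
move=> /functional_atomic[F uF Fphi]; exists F => // U.
apply: mass_le => // f fU; have := Fphi f (uballS (@subsetT _ _) fU).
rewrite ler_norml => /andP[_]; rewrite lerBlDl => /le_trans; apply.
rewrite lerD2r [leRHS]big_mkcond/=; apply: ler_sum => x _.
case: asboolP => [Ux|Ux]; last by rewrite (uball_out fU)// mulr0.
apply: le_trans (ler_norm _) _; rewrite normrM -[leRHS]mulr1 ler_pM//.
exact: uball_le1 fU.
Qed.

Lemma mass_le_sum_mu_mem (x : K) (e : R) : 0 < e -> exists G : seq K,
  [/\ uniq G, x \in G & mass phi setT <= \sum_(y <- G) `|mu phi y| + e].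
Proof.
move=> /mass_le_sum_mu[F uF /(_ setT) FT].
exists (undup (x :: F)); split; [exact: undup_uniq|by rewrite mem_undup mem_head|].
apply: le_trans FT _; rewrite lerD2r (eq_bigl xpredT); last by move=> y; rewrite asboolT.
by rewrite /=; case: ifP => xF; rewrite undup_id// big_cons lerDr.
Qed.

End one.
End atomic.

(** * Masses of families of open sets determine a functional *)

Section family_mass.
Variables (R : realType) (K : topologicalType).
Implicit Types (f g : Cspace K R) (U V : set K) (phi : Cspace K R -> R^o).

Definition family_mass (VV : set_system K) phi : R := sup [set mass phi U | U in VV].

Lemma mass_le_family_mass (VV : set_system K) phi U : sup_bounded phi -> VV U ->
  mass phi U <= family_mass VV phi.
Proof.
move=> sphi VU; apply: ub_le_sup; last by exists U.
by exists (mass phi setT) => _ [V _ <-]; exact: mass_mono.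
Qed.

Lemma family_mass_le (VV : set_system K) phi (c : R) : VV !=set0 ->
  (forall U, VV U -> mass phi U <= c) -> family_mass VV phi <= c.
Proof.
move=> [V VVV] VVc; apply: ge_sup; first by exists (mass phi V), V.
by move=> _ [U VU <-]; exact: VVc.
Qed.

Lemma family_mass_ge0 (VV : set_system K) phi : sup_bounded phi -> VV !=set0 ->
  0 <= family_mass VV phi.
Proof.
move=> sphi [V VVV]; apply: le_trans (mass_le_family_mass sphi VVV).
exact: mass_ge0.
Qed.

Lemma C_bounded f : compact [set: K] -> exists2 M : R, 0 < M & forall x, `|f x : R| <= M.
Proof.
move=> cK; have [||||B [M M0 BM] KB] := @compact_ind K
    (fun U => exists2 M : R, 0 < M & forall x, U x -> `|f x : R| <= M) setT.
- by exists 1.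
- move=> B C [M M0 BM] [L L0 CL]; exists (M + L); first exact: addr_gt0.
  move=> x [/BM/le_trans|/CL/le_trans]; apply.
    by rewrite lerDl ltW.
  by rewrite lerDr ltW.
- exact: cK.
- move=> x _; exists [set y | `|f y : R| < `|f x : R| + 1].
    by have /cvgr_norm_lt := @cts_fun _ _ f x; apply; rewrite ltrDl.
  by exists (`|f x : R| + 1) => [|y /ltW//]; rewrite ltr_wpDl.
- by exists M => // x; apply: BM; exact: KB.
Qed.

Section convex.
Variables (phi psi theta : Cspace K R -> R^o) (a : R).
Hypotheses (sphi : sup_bounded phi) (spsi : sup_bounded psi) (stheta : sup_bounded theta).
Hypothesis a01 : 0 < a < 1.
Hypothesis thetaE : forall f, (theta f : R) = a * phi f + (1 - a) * psi f.

Let a_ge0 : 0 <= a. Proof. by case/andP: a01 => *; lra. Qed.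
Let a'_ge0 : 0 <= 1 - a. Proof. by case/andP: a01 => *; lra. Qed.

Lemma mass_convex U : mass theta U <= a * mass phi U + (1 - a) * mass psi U.
Proof.
apply: mass_le => // f fU; rewrite thetaE.
by rewrite lerD// ler_wpM2l// le_mass.
Qed.

Lemma family_mass_convex (VV : set_system K) : VV !=set0 ->
  family_mass VV theta <= a * family_mass VV phi + (1 - a) * family_mass VV psi.
Proof.
move=> VV0; apply: family_mass_le => // U VU; apply: le_trans (mass_convex U) _.
by rewrite lerD// ler_wpM2l// mass_le_family_mass.
Qed.

End convex.
End family_mass.

Section eq_of_equal_masses.
Variables (R : realType) (K : topologicalType).
Hypothesis Kclopen : forall (x : K) (U : set K), nbhs x U ->
  exists V, [/\ clopen V, V x & V `<=` U].
Hypothesis Khaus : hausdorff_space K.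
Hypothesis Kcompact : compact [set: K].
Hypothesis Kscat : forall A : set K, A !=set0 -> isolated A !=set0.
Implicit Types (f g : Cspace K R) (U V : set K) (phi : Cspace K R -> R^o).

Variables (pt : K) (UU : nat -> set_system K).
Hypothesis UUopen : forall n U, UU n U -> open U.
Hypothesis UUpt : forall n U, UU n U -> ~ U pt.
Hypothesis UUcov : forall n x, x <> pt -> exists2 U, UU n U & U x.
Hypothesis UUsep : forall x y, x <> y -> exists m, forall n U, (m <= n)%N ->
  UU n U -> U x -> U y -> False.

Definition unions n k : set_system K := [set V | exists s : seq (set K),
  [/\ (size s <= k)%N, forall U, U \in s -> UU n U &
      V = \bigcup_(U in [set` s]) U]].

Lemma unions_neq0 n k : unions n k !=set0.
Proof. by exists (\bigcup_(U in [set` [::]]) U), [::]; split. Qed.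

Lemma unions_open n k U : unions n k U -> open U.
Proof. by move=> [s [_ sU ->]]; apply: bigcup_open => V /sU/UUopen. Qed.

(** One member of the cover around each point of A gives a union of at most k sets
    that contains A. *)
Lemma sum_mu_le_unions phi (A : seq K) n k : sup_bounded phi -> uniq A ->
  (size A <= k)%N -> pt \notin A ->
  \sum_(x <- A) `|mu phi x| <= family_mass (unions n k) phi.
Proof.
move=> sphi uA Ak Apt.
have /choice[g gP] : forall x, exists V : set K, x \in A -> UU n V /\ V x.
  move=> x; have [xA|xA] := boolP (x \in A).
    have [|U UU' Ux] := @UUcov n x; first by move=> xpt; rewrite -xpt xA in Apt.
    by exists U.
  by exists setT => xA'; case/negP: xA.
have VA : unions n k (\bigcup_(U in [set` map g A]) U).
  exists (map g A); split=> //; first by rewrite size_map.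
  by move=> U /mapP[x xA ->]; case: (gP x xA).
apply: le_trans (mass_le_family_mass sphi VA).
apply: (sum_mu_le_mass Kclopen) => //; first exact: unions_open VA.
move=> x xA; exists (g x); first by rewrite /= map_f.
by case: (gP x xA).
Qed.

Lemma UUsep_seq (F : seq K) : exists n, forall U x y, x \in F -> y \in F ->
  UU n U -> U x -> U y -> x = y.
Proof.
have /choice[N NP] : forall p : K * K, exists m, p.1 <> p.2 ->
    forall n U, (m <= n)%N -> UU n U -> U p.1 -> U p.2 -> False.
  move=> [x y] /=; have [->|/UUsep[m mP]] := pselect (x = y).
    by exists 0%N.
  by exists m.
exists (\max_(x <- F) \max_(y <- F) N (x, y)) => U x y xF yF UU' Ux Uy.
apply: contrapT => /(NP (x, y))/= /(_ _ U _ UU' Ux Uy); apply.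
apply: (@leq_trans (\max_(z <- F) N (x, z))).
  exact: (@leq_bigmax_seq _ F xpredT (fun z => N (x, z)) y).
exact: (@leq_bigmax_seq _ F xpredT (fun w => \max_(z <- F) N (w, z)) x).
Qed.

(** Up to e the variation sits on a finite set F. For n large no member of the
    n-th family contains two points of F, so a union of k members meets F in at
    most k points. *)
Lemma unions_le_sum_mu phi k (c : R) : sup_bounded phi ->
  (forall B : seq K, uniq B -> (size B <= k)%N -> pt \notin B ->
    \sum_(x <- B) `|mu phi x| <= c) ->
  forall e : R, 0 < e -> exists n, family_mass (unions n k) phi <= c + e.
Proof.
move=> sphi kc e e0.
have [F uF FP] := mass_le_sum_mu Kclopen Kcompact Kscat sphi e0.
have [n nP] := UUsep_seq F.
exists n; apply: family_mass_le; first exact: unions_neq0.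
move=> U [s [sk sUU UE]]; apply: le_trans (FP U) _; rewrite lerD2r -big_filter.
have /choice[g gP] : forall x, exists V : set K, U x -> V \in s /\ V x.
  move=> x; have [|Ux] := pselect (U x); last by exists set0.
  by rewrite {1}UE => -[V /= Vs Vx]; exists V.
set B := [seq x <- F | _]; have BE x : x \in B -> x \in F /\ U x.
  by rewrite mem_filter => /andP[/asboolP].
apply: kc; first exact: filter_uniq.
  apply: leq_trans sk; rewrite -(size_map g); apply: uniq_leq_size.
    rewrite map_inj_in_uniq ?filter_uniq// => x y /BE[xF Ux] /BE[yF Uy] gxy.
    have [gxs gxx] := gP _ Ux; have [_ gyy] := gP _ Uy.
    apply: (nP (g x)) => //; first exact: sUU.
    by rewrite gxy.
  by move=> _ /mapP[x /BE[_ Ux] ->]; case: (gP _ Ux).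
apply/negP => /BE[_]; rewrite UE => -[V /= /sUU]; exact: UUpt.
Qed.

Lemma mu_lincomb (phi psi theta : Cspace K R -> R^o) (a b : R) x :
  sup_bounded phi -> sup_bounded psi -> sup_bounded theta ->
  (forall f, (theta f : R) = a * phi f + b * psi f) ->
  mu theta x = a * mu phi x + b * mu psi x.
Proof.
move=> sphi spsi stheta thetaE; apply: (mu_atom Kclopen) => // e e0.
pose d := e / (`|a| + `|b| + 1).
have d0 : 0 < d by rewrite divr_gt0// ltr_wpDl// addr_ge0.
have [V [cV Vx Vphi]] := muP Kclopen sphi x d0.
have [U [cU Ux Upsi]] := muP Kclopen spsi x d0.
exists (V `&` U); split=> //; first exact: clopenI.
move=> f fVU; have {}Vphi := Vphi _ (uballS (@subIsetl _ _ _) fVU).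
have {}Upsi := Upsi _ (uballS (@subIsetr _ _ _) fVU).
have -> : (theta f : R) - (a * mu phi x + b * mu psi x) * f x =
    a * (phi f - mu phi x * f x) + b * (psi f - mu psi x * f x).
  by rewrite thetaE; ring.
apply: le_trans (ler_normD _ _) _; rewrite !normrM.
apply: (@le_trans _ _ (`|a| * d + `|b| * d)).
  by apply: lerD; apply: ler_wpM2l.
rewrite -mulrDl /d mulrCA ler_piMr//; first exact: ltW.
by rewrite ler_pdivrMr ?mul1r ?lerDl// ltr_wpDl// addr_ge0.
Qed.

Section three.
Variables (phi psi theta : Cspace K R -> R^o) (a : R).
Hypotheses (sphi : sup_bounded phi) (spsi : sup_bounded psi) (stheta : sup_bounded theta).
Hypothesis a01 : 0 < a < 1.
Hypothesis thetaE : forall f, (theta f : R) = a * phi f + (1 - a) * psi f.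
Hypothesis mass_eqT : mass phi setT = mass theta setT /\ mass psi setT = mass theta setT.
Hypothesis family_mass_eq : forall n k,
  family_mass (unions n k) phi = family_mass (unions n k) theta /\
  family_mass (unions n k) psi = family_mass (unions n k) theta.

Let a_gt0 : 0 < a. Proof. by case/andP: a01. Qed.
Let a'_gt0 : 0 < 1 - a. Proof. by case/andP: a01 => *; lra. Qed.

Lemma mu_convex x : mu theta x = a * mu phi x + (1 - a) * mu psi x.
Proof. exact: mu_lincomb. Qed.

(** Triangle inequality at every point, and equality for the totals. *)
Lemma norm_mu_convex x : `|mu theta x| = a * `|mu phi x| + (1 - a) * `|mu psi x|.
Proof.
have le_th y : `|mu theta y| <= a * `|mu phi y| + (1 - a) * `|mu psi y|.
  rewrite mu_convex; apply: le_trans (ler_normD _ _) _.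
  by rewrite !normrM (gtr0_norm a_gt0) (gtr0_norm a'_gt0).
apply/eqP; rewrite eq_le le_th/=; apply/ler_addgt0Pr => e e0.
have [G [uG xG FT]] := mass_le_sum_mu_mem Kclopen Kcompact Kscat stheta x e0.
have Gphi := sum_mu_le_mass Kclopen Khaus sphi uG openT (fun _ _ => I).
have Gpsi := sum_mu_le_mass Kclopen Khaus spsi uG openT (fun _ _ => I).
move: FT Gphi Gpsi; rewrite !(big_rem x xG)/=.
have := @ler_sum R K (rem x G) xpredT _ _ (fun y _ => le_th y).
rewrite big_split/= -!mulr_sumr.
case: mass_eqT => -> ->.
set st := \sum_(_ <- _) _; set sp := \sum_(_ <- _) _; set sq := \sum_(_ <- rem _ _) _.
move=> le_rem le_st le_sp le_sq.
have := ler_wpM2l (ltW a_gt0) le_sp; have := ler_wpM2l (ltW a'_gt0) le_sq.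
lra.
Qed.

Let mean_eq (u v w : R) : u <= w -> v <= w -> w = a * u + (1 - a) * v -> u = v.
Proof. by move: a_gt0 a'_gt0 => *; nra. Qed.

(** For a set A of k largest masses of theta, the k-th limit bounds the sums over A
    for phi and psi by the one for theta, which is their convex combination. *)
Let sum_eq (A : seq K) : uniq A -> pt \notin A ->
  (forall B : seq K, uniq B -> (size B <= size A)%N -> pt \notin B ->
    \sum_(x <- B) `|mu theta x| <= \sum_(x <- A) `|mu theta x|) ->
  \sum_(x <- A) `|mu phi x| = \sum_(x <- A) `|mu psi x|.
Proof.
move=> uA Apt Atop; apply: (@mean_eq _ _ (\sum_(x <- A) `|mu theta x|)).
- apply/ler_addgt0Pr => e e0.
  have [n nP] := unions_le_sum_mu stheta Atop e0.
  apply: le_trans nP; rewrite -(family_mass_eq n (size A)).1.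
  exact: sum_mu_le_unions.
- apply/ler_addgt0Pr => e e0.
  have [n nP] := unions_le_sum_mu stheta Atop e0.
  apply: le_trans nP; rewrite -(family_mass_eq n (size A)).2.
  exact: sum_mu_le_unions.
- by rewrite !mulr_sumr -big_split; apply: eq_bigr => x _; exact: norm_mu_convex.
Qed.

(** Let A be the points of D where theta has more mass than at y. Both A and
    y :: A are sets of largest masses for theta of their size, by comparing
    excesses over the mass at y; [sum_eq] applies to both, and the difference of
    the sums is the mass at y. *)
Let norm_mu_eq_off y : y <> pt -> `|mu phi y| = `|mu psi y|.
Proof.
move=> ypt; pose c := `|mu theta y|.
have : 0 <= c by exact: normr_ge0.
rewrite le_eqVlt => /predU1P[c0|c0].
  have /esym/eqP := norm_mu_convex y; rewrite -/c -c0.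
  have a0 := ltW a_gt0; have a1 := ltW a'_gt0.
  rewrite paddr_eq0 ?(mulr_ge0 a0)// ?(mulr_ge0 a1)// !mulf_eq0 !(gt_eqF a_gt0, gt_eqF a'_gt0)/=.
  by move=> /andP[/eqP-> /eqP->].
have [F uF FP] := mass_le_sum_mu Kclopen Kcompact Kscat stheta c0.
have FA x : c < `|mu theta x| -> x \in F.
  apply: contraTT => xF; rewrite -leNgt.
  have oF : open (~` [set` F]).
    apply: closed_openC; have -> : [set` F] = \bigcup_(z in [set` F]) [set z].
      by apply/seteqP; split=> [z|_ [z] ? ->]//; exists z.
    apply: closed_bigcup => [|z _]; first exact: finite_seq.
    exact/accessible_closed_set1/hausdorff_accessible.
  have := sum_mu_le_mass Kclopen Khaus stheta (isT : uniq [:: x]) oF.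
  rewrite big_seq1 => /(_ _)/le_trans; apply; first by move=> z; rewrite inE => /eqP->; exact/negP.
  apply: le_trans (FP _) _; rewrite big1_seq ?add0r// => z /andP[/asboolP zF zF'].
  by case: zF.
pose A := [seq x <- F | (x != pt) && (c < `|mu theta x|)].
have uA : uniq A by exact: filter_uniq.
have AE x : (x \in A) = (x != pt) && (c < `|mu theta x|).
  by rewrite mem_filter; case: ltP => [/FA->|]; rewrite ?andbT ?andbF.
have Apt : pt \notin A by rewrite AE eqxx.
have yA : y \notin A by rewrite AE ltxx andbF.
(* A contains exactly the points of positive excess over c. *)
have excess (B : seq K) : uniq B -> pt \notin B ->
    \sum_(x <- B) (`|mu theta x| - c) <= \sum_(x <- A) (`|mu theta x| - c).
  move=> uB Bpt.
  rewrite (bigID (fun x => x \in A))/= [leRHS](bigID (fun x => x \in B))/=.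
  apply: lerD.
    rewrite le_eqVlt; apply/orP; left; apply/eqP.
    rewrite -[LHS]big_filter -[RHS]big_filter; apply: perm_big.
    apply: uniq_perm; rewrite ?filter_uniq// => x.
    by rewrite !mem_filter andbC.
  apply: (@le_trans _ _ 0).
    rewrite big_seq_cond; apply: sumr_le0 => x /andP[xB].
    rewrite AE negb_and negbK subr_le0 -leNgt => /orP[/eqP xpt|//].
    by rewrite -xpt xB in Bpt.
  rewrite big_seq_cond; apply: sumr_ge0 => x /andP[].
  by rewrite AE subr_ge0 => /andP[_ /ltW].
have sumE (B : seq K) : \sum_(x <- B) `|mu theta x| =
    \sum_(x <- B) (`|mu theta x| - c) + c * (size B)%:R.
  by rewrite big_split/= big_const_seq iter_addr_0 count_predT mulNrn mulr_natr subrK.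
have topA : \sum_(x <- A) `|mu phi x| = \sum_(x <- A) `|mu psi x|.
  apply: sum_eq => // B uB Bs Bpt; rewrite !sumE lerD ?excess//.
  by rewrite ler_pM2l// ler_nat.
have topyA : \sum_(x <- y :: A) `|mu phi x| = \sum_(x <- y :: A) `|mu psi x|.
  apply: sum_eq => [||B uB Bs Bpt].
  - by rewrite /= yA.
  - by rewrite inE negb_or Apt andbT eq_sym; apply/eqP.
  - rewrite !sumE lerD//; first by rewrite big_cons subrr add0r excess.
    by rewrite ler_pM2l// ler_nat.
by move: topyA; rewrite !big_cons topA => /addIr.
Qed.

(** The mass at pt is the total variation minus the masses elsewhere. *)
Let norm_mu_le_pt (phi1 phi2 : Cspace K R -> R^o) :
  sup_bounded phi1 -> sup_bounded phi2 -> mass phi1 setT = mass phi2 setT ->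
  (forall y, y <> pt -> `|mu phi1 y| = `|mu phi2 y|) ->
  `|mu phi1 pt| <= `|mu phi2 pt|.
Proof.
move=> s1 s2 v12 m12; apply/ler_addgt0Pr => e e0.
have [G [uG ptG FT]] := mass_le_sum_mu_mem Kclopen Kcompact Kscat s2 pt e0.
have := sum_mu_le_mass Kclopen Khaus s1 uG openT (fun _ _ => I).
move: FT; rewrite !(big_rem pt ptG)/=.
have -> : \sum_(y <- rem pt G) `|mu phi1 y| = \sum_(y <- rem pt G) `|mu phi2 y|.
  apply: eq_big_seq => y; rewrite mem_rem_uniq// inE => /andP[/eqP ypt _].
  exact: m12.
by rewrite v12; lra.
Qed.

(** Equality in the triangle inequality makes the masses equal and not opposite;
    then phi - psi has no mass, and vanishes by atomicity. *)
Lemma eq_of_equal_masses f : phi f = psi f.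
Proof.
have mE x : `|mu phi x| = `|mu psi x|.
  have [->|/norm_mu_eq_off//] := pselect (x = pt).
  have v12 : mass phi setT = mass psi setT by case: mass_eqT => -> ->.
  apply/eqP; rewrite eq_le !norm_mu_le_pt// => y /norm_mu_eq_off//.
have {}mE x : mu phi x = mu psi x.
  have := norm_mu_convex x; rewrite mu_convex -(mE x).
  have /eqP := mE x; rewrite eqr_norm2 => /orP[/eqP//|/eqP ->].
  rewrite normrN -mulrDl [a + _]addrC subrK mul1r => /eqP.
  set v := mu psi x; rewrite eqr_norm2 => /orP[]/eqP vE.
    have /eqP : a * v = 0 by lra.
    by rewrite mulf_eq0 (gt_eqF a_gt0)/= => /eqP->; rewrite oppr0.
  have /eqP : (1 - a) * v = 0 by lra.
  by rewrite mulf_eq0 (gt_eqF a'_gt0)/= => /eqP->; rewrite oppr0.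
pose chi : Cspace K R -> R^o := fun f => phi f - psi f.
have schi : sup_bounded chi.
  have [lphi [C C0 Cphi]] := sphi; have [lpsi [D D0 Dpsi]] := spsi.
  split.
    by move=> b g h; rewrite /chi lphi lpsi scalerBr opprD addrACA.
  exists (C + D); first exact: addr_ge0.
  move=> g M gM; apply: le_trans (ler_normB _ _) _.
  by rewrite mulrDl lerD// ?Cphi ?Dpsi.
have mchi x : mu chi x = 0.
  rewrite (@mu_lincomb phi psi chi 1 (-1))// => [|g]; first by rewrite mE; ring.
  by rewrite /chi mul1r mulN1r.
have [M M0 fM] := C_bounded f Kcompact.
have gT : uball R setT (M^-1 *: f).
  move=> x; rewrite indic_in// C_scaleE normrM gtr0_norm ?invr_gt0//.
  by rewrite ler_pdivrMl// mulr1.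
apply/eqP; rewrite -subr_eq0 -/(chi f).
have -> : f = M *: (M^-1 *: f) by rewrite scalerA divff ?scale1r// gt_eqF.
rewrite linZ// mulf_eq0 gt_eqF//= -normr_le0.
apply/ler_addgt0Pr => e e0; rewrite add0r.
have [F _ /(_ _ gT)] := functional_atomic Kclopen Kcompact Kscat schi e0.
by rewrite big1 ?subr0// => x _; rewrite mchi mul0r.
Qed.

End three.
End eq_of_equal_masses.

(** * The renorming *)

Section weights.
Variable R : realType.

Definition weight (i : nat) : R := 2^-1 ^+ i.+1.

Lemma weight_gt0 i : 0 < weight i.
Proof. by rewrite exprn_gt0// invr_gt0. Qed.

Lemma weight_ge0 i : 0 <= weight i.
Proof. exact/ltW/weight_gt0. Qed.

Lemma sum_sqr_weight l : \sum_(i < l) weight i ^+ 2 <= 1.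
Proof.
apply: (@le_trans _ _ (1 - 2^-1 ^+ l)); last by rewrite gerBl exprn_ge0// invr_ge0.
elim: l => [|l IH]; first by rewrite big_ord0 expr0 subrr.
rewrite big_ord_recr/=; apply: le_trans (lerD IH (lexx _)) _.
have : weight l <= 1 by rewrite exprn_ile1// ?invr_ge0// invf_le1// ler1n.
have := weight_gt0 l; have : 2^-1 ^+ l = 2 * weight l.
  by rewrite /weight exprS mulrA divff// mul1r.
rewrite -/(weight l) => ->; nra.
Qed.

End weights.

Lemma sqr_convex (R : comNzRingType) (a u v : R) :
  (a * u + (1 - a) * v) ^+ 2 =
  a * u ^+ 2 + (1 - a) * v ^+ 2 - a * (1 - a) * (u - v) ^+ 2.
Proof. ring. Qed.

(** Strict convexity of l2, in the form needed for a norm that is known only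
    through bounds on partial sums: the last hypothesis says that the partial
    sums of t ^+ 2 have supremum at least 1. *)
Lemma sum_sqr_rigid (R : realType) (p q t : nat -> R) (a : R) : 0 < a < 1 ->
  (forall j, 0 <= p j) -> (forall j, 0 <= q j) -> (forall j, 0 <= t j) ->
  (forall j, t j <= a * p j + (1 - a) * q j) ->
  (forall l, \sum_(j < l) p j ^+ 2 <= 1) ->
  (forall l, \sum_(j < l) q j ^+ 2 <= 1) ->
  (forall rho, 0 < rho -> (forall l, \sum_(j < l) t j ^+ 2 <= rho ^+ 2) -> 1 <= rho) ->
  forall i, p i = t i /\ q i = t i.
Proof.
move=> /andP[a0 a1] p0 q0 t0 tpq sp sq st i.
have a'0 : 0 < 1 - a by rewrite subr_gt0.
have cvxp (b : R) : a * b + (1 - a) * b = b by rewrite -mulrDl addrC subrK mul1r.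
have aa0 : 0 < a * (1 - a) by rewrite mulr_gt0.
have tpq2 j : t j ^+ 2 <= a * p j ^+ 2 + (1 - a) * q j ^+ 2 -
    a * (1 - a) * (p j - q j) ^+ 2.
  rewrite -sqr_convex lerXn2r// nnegrE//.
  by rewrite addr_ge0// mulr_ge0// ltW.
have cvx j : t j ^+ 2 <= a * p j ^+ 2 + (1 - a) * q j ^+ 2.
  by apply: le_trans (tpq2 j) _; rewrite gerBl mulr_ge0 ?sqr_ge0// ltW.
have gap0 : a * p i ^+ 2 + (1 - a) * q i ^+ 2 <= t i ^+ 2.
  rewrite leNgt; apply/negP => gap.
  pose gamma := a * p i ^+ 2 + (1 - a) * q i ^+ 2 - t i ^+ 2.
  have gamma0 : 0 < gamma by rewrite subr_gt0.
  have sumt l : \sum_(j < l) t j ^+ 2 <= 1 - gamma.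
    apply: (@le_trans _ _ (\sum_(j < l + i.+1) t j ^+ 2)).
      by rewrite big_split_ord/= lerDl sumr_ge0// => j _; exact: sqr_ge0.
    have ilt : (i < l + i.+1)%N by rewrite addnS ltnS leq_addl.
    rewrite lerBrDr; apply: (@le_trans _ _ (a * \sum_(j < l + i.+1) p j ^+ 2 +
        (1 - a) * \sum_(j < l + i.+1) q j ^+ 2)); last first.
      by rewrite -[leRHS](cvxp 1) lerD// ler_pM2l.
    rewrite !mulr_sumr -big_split/= (bigD1 (Ordinal ilt))//= [leRHS](bigD1 (Ordinal ilt))//=.
    rewrite addrAC /gamma [t i ^+ 2 + _]addrC subrK lerD2l; apply: ler_sum => j _.
    exact: cvx.
  (* 4^-1 only keeps rho2 positive. *)
  pose rho2 : R := Num.max (1 - gamma) 4^-1.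
  have rho20 : 0 < rho2 by rewrite lt_max invr_gt0 ltr0n orbT.
  have rho21 : rho2 < 1 by rewrite gt_max gtrBl gamma0/= invf_lt1// ltr1n.
  have : Num.sqrt rho2 < 1 by rewrite -[ltRHS]sqrtr1 ltr_sqrt.
  rewrite ltNge => /negP; apply; apply: st; first by rewrite sqrtr_gt0.
  move=> l; rewrite sqr_sqrtr; last exact: ltW.
  by rewrite le_max sumt.
have pq : p i = q i.
  have : a * (1 - a) * (p i - q i) ^+ 2 <= 0.
    by have := le_trans gap0 (tpq2 i); rewrite lerBrDr gerDl.
  rewrite pmulr_rle0// => pq2.
  have : (p i - q i) ^+ 2 == 0 by rewrite eq_le pq2 sqr_ge0.
  by rewrite sqrf_eq0 subr_eq0 => /eqP.
suff pt : p i = t i by rewrite -pq.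
apply/eqP; rewrite eq_le; apply/andP; split; last first.
  by have := tpq i; rewrite -pq cvxp.
by move: gap0; rewrite -pq cvxp ler_pXn2r// nnegrE.
Qed.

Section norm.
Variables (R : realType) (K : topologicalType).
Hypothesis Kcompact : compact [set: K].
Variable VV : nat -> set_system K.
Hypothesis VV0 : VV 0%N setT.
Variable x0 : K.
Hypothesis VV_neq0 : forall i, VV i !=set0.
Implicit Types (f g : Cspace K R) (U V : set K) (phi : Cspace K R -> R^o).
Implicit Types (s : seq (K * R)) (h : K -> R).

(** The integral of h for the finitely supported measure that puts mass p.2 at p.1,
    for p in s. *)
Definition pairing s h : R := \sum_(p <- s) p.2 * h p.1.

Definition nonneg s := forall p, p \in s -> 0 <= p.2.

(** The unit ball of the intended dual norm, among positive finitely supported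
    measures: the sequence r bounds the weighted seminorms and has l2-norm at
    most 1. *)
Definition admissible s : Prop := nonneg s /\ exists r : nat -> R,
  (forall i U, VV i U -> weight R i * pairing s \1_U <= r i) /\
  forall l, \sum_(i < l) r i ^+ 2 <= 1.

(** A supremum of lattice seminorms; so the norm and lattice properties are
    immediate, and all the work goes to its dual norm. *)
Definition renorm f : R := sup [set pairing s (fun x => `|f x|) | s in admissible].

Lemma pairing_le s h h' : nonneg s -> (forall x, h x <= h' x) ->
  pairing s h <= pairing s h'.
Proof.
move=> s0 hh'; rewrite /pairing big_seq [leRHS]big_seq; apply: ler_sum => p ps.
by rewrite ler_wpM2l// s0.
Qed.

Lemma pairingD s h h' : pairing s (fun x => h x + h' x) = pairing s h + pairing s h'.
Proof. by rewrite /pairing -big_split; apply: eq_bigr => p _; rewrite mulrDr. Qed.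

Lemma pairingZ s (c : R) h : pairing s (fun x => c * h x) = c * pairing s h.
Proof. by rewrite /pairing mulr_sumr; apply: eq_bigr => p _; rewrite mulrCA. Qed.

Lemma pairing_sum s l (h : 'I_l -> K -> R) :
  pairing s (fun x => \sum_(i < l) h i x) = \sum_(i < l) pairing s (h i).
Proof.
by rewrite /pairing exchange_big; apply: eq_bigr => p _; rewrite mulr_sumr.
Qed.

Lemma admissible_nil : admissible [::].
Proof.
split=> //; exists (fun=> 0); split=> [i U _|l].
  by rewrite /pairing big_nil mulr0.
by rewrite big1// => i _; rewrite expr0n.
Qed.

Lemma admissible_dirac x : admissible [:: (x, 1)].
Proof.
split; first by move=> p; rewrite inE => /eqP->/=.
exists (weight R); split; last exact: sum_sqr_weight.
by move=> i U _; rewrite /pairing big_seq1 mul1r ler_piMr ?weight_ge0 ?indic_le1.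
Qed.

Lemma pairing_admissible_le s h (M : R) : admissible s -> (forall x, h x <= M) ->
  0 <= M -> pairing s h <= 2 * M.
Proof.
move=> [s0 [r [/(_ 0%N _ VV0) rs /(_ 1%N)]]].
rewrite big_ord1 => r1 hM M0; apply: (@le_trans _ _ (pairing s (fun x => M * \1_setT x))).
  by apply: pairing_le => // x; rewrite indic_in// mulr1.
rewrite pairingZ mulrC ler_wpM2r//.
move: rs; rewrite /weight expr1 => rs; nra.
Qed.

Lemma renorm_le f (c : R) :
  (forall s, admissible s -> pairing s (fun x => `|f x|) <= c) -> renorm f <= c.
Proof.
move=> sc; apply: ge_sup; last by move=> _ [s /sc ? <-].
by exists (pairing [::] (fun x => `|f x|)), [::] => //; exact: admissible_nil.
Qed.

Lemma le_renorm f s : admissible s -> pairing s (fun x => `|f x|) <= renorm f.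
Proof.
move=> sa; apply: ub_le_sup; last by exists s.
have [M M0 fM] := C_bounded f Kcompact.
exists (2 * M) => _ [t ta <-]; apply: pairing_admissible_le => //; exact: ltW.
Qed.

Lemma renorm_le_bound f (M : R) : 0 <= M -> (forall x, `|f x : R| <= M) -> renorm f <= 2 * M.
Proof. by move=> M0 fM; apply: renorm_le => s sa; exact: pairing_admissible_le. Qed.

Lemma norm_le_renorm f x : `|f x : R| <= renorm f.
Proof.
apply: le_trans (le_renorm f (admissible_dirac x)).
by rewrite /pairing big_seq1 mul1r.
Qed.

Lemma renorm_ge0 f : 0 <= renorm f.
Proof. by have := le_renorm f admissible_nil; rewrite /pairing big_nil. Qed.

Lemma renorm_lattice : lattice_norm renorm.
Proof.
move=> f g fg; apply: renorm_le => s sa; apply: le_trans (le_renorm g sa).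
by apply: pairing_le => //; case: sa.
Qed.

Lemma renorm_norm : is_norm renorm.
Proof.
have leZ (a : R) f : renorm (a *: f) <= `|a| * renorm f.
  apply: renorm_le => s sa.
  rewrite (_ : (fun x => `|(a *: f) x : R|) = fun x => `|a| * `|f x : R|); last first.
    by apply/funext => x; rewrite C_scaleE normrM.
  by rewrite pairingZ ler_wpM2l// le_renorm.
split.
- exact: renorm_ge0.
- move=> f f0; apply: C_eq => x; apply/eqP; rewrite -normr_le0 -f0.
  exact: norm_le_renorm.
- move=> a f; apply/eqP; rewrite eq_le leZ/=.
  have [->|a0] := eqVneq a 0; first by rewrite normr0 mul0r renorm_ge0.
  rewrite -ler_pdivlMl ?normr_gt0// -normfV; apply: le_trans (leZ _ _).
  by rewrite scalerA mulVf// scale1r.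
- move=> f g; apply: renorm_le => s sa.
  apply: le_trans (lerD (le_renorm f sa) (le_renorm g sa)).
  rewrite -pairingD; apply: pairing_le; first by case: sa.
  by move=> x; rewrite C_addE ler_normD.
Qed.

Lemma renorm_equivalent : equivalent_norms renorm (@sup_norm K R).
Proof.
exists 1, 2; split=> // f; rewrite mul1r; apply/andP; split.
  apply: ge_sup; first by exists `|f x0 : R|, x0.
  by move=> _ [x _ <-]; exact: norm_le_renorm.
have le_sup x : `|f x : R| <= sup_norm f.
  apply: ub_le_sup; last by exists x.
  have [M _ fM] := C_bounded f Kcompact.
  by exists M => _ [y _ <-].
by apply: renorm_le_bound => //; exact: le_trans (le_sup x0).
Qed.

Lemma dual_sup_bounded phi : dual renorm phi -> sup_bounded phi.
Proof.
move=> [lphi [C phiC]]; split=> //; exists (`|C| * 2); first exact: mulr_ge0.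
move=> f M fM; apply: le_trans (phiC f) _.
apply: (@le_trans _ _ (`|C| * renorm f)); first by rewrite ler_wpM2r ?ler_norm ?renorm_ge0.
rewrite -mulrA ler_wpM2l// renorm_le_bound//; exact: le_trans (fM x0).
Qed.

Lemma dual_norm_le1 phi : dual renorm phi -> dual_norm renorm phi <= 1 ->
  forall f, `|phi f : R| <= renorm f.
Proof.
move=> dphi phi1 f; have sphi := dual_sup_bounded dphi; have [_ N0 NZ _] := renorm_norm.
have [/N0->|Nf] := eqVneq (renorm f) 0; first by rewrite lin0// normr0 renorm_ge0.
have Nf0 : 0 < renorm f by rewrite lt_neqAle eq_sym Nf renorm_ge0.
have : `|phi ((renorm f)^-1 *: f) : R| <= 1.
  apply: le_trans phi1; apply: ub_le_sup.
    have [_ [C phiC]] := dphi; exists `|C| => _ [g /= g1 <-].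
    apply: le_trans (phiC g) _; rewrite -[leRHS]mulr1.
    apply: (@le_trans _ _ (`|C| * renorm g)); first by rewrite ler_wpM2r ?ler_norm ?renorm_ge0.
    by rewrite ler_wpM2l.
  exists ((renorm f)^-1 *: f) => //=.
  by rewrite NZ normfV gtr0_norm// mulVf.
by rewrite linZ// normrM normfV (gtr0_norm Nf0) ler_pdivrMl// mulr1.
Qed.

Lemma dual_norm_le phi (rho : R) : 0 <= rho ->
  (forall f, `|phi f : R| <= rho * renorm f) -> dual_norm renorm phi <= rho.
Proof.
move=> rho0 phirho; apply: ge_sup.
  exists `|phi 0 : R|, 0 => //=; have [_ _ NZ _] := renorm_norm.
  by rewrite -(scale0r (0 : Cspace K R)) NZ normr0 mul0r.
move=> _ [f /= f1 <-]; apply: le_trans (phirho f) _.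
by rewrite -[leRHS]mulr1 ler_wpM2l.
Qed.

Definition weighted_mass i phi : R := weight R i * family_mass (VV i) phi.

Lemma weighted_mass_ge0 i phi : sup_bounded phi -> 0 <= weighted_mass i phi.
Proof. by move=> sphi; rewrite mulr_ge0 ?weight_ge0// family_mass_ge0. Qed.

(** Take f i almost norming for the i-th seminorm p i of phi, and test phi against
    the sum of p i * weight i * f i. By 2 p r <= p^2 + r^2 its norm is at most
    (S + 1) / 2, where S is the sum of the p i ^+ 2, while phi takes a value close
    to S on it; hence S <= 1. *)
Lemma sum_weighted_mass_le1 phi l : sup_bounded phi -> (forall f, `|phi f : R| <= renorm f) ->
  \sum_(i < l) weighted_mass i phi ^+ 2 <= 1.
Proof.
move=> sphi phiN; apply/ler_addgt0Pr => e e0.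
pose S : R := \sum_(i < l) weighted_mass i phi.
have S0 : 0 <= S by apply: sumr_ge0 => i _; exact: weighted_mass_ge0.
pose d := e / 2 / (S + 1).
have d0 : 0 < d by rewrite !divr_gt0// ltr_wpDl.
have dS : S * d <= e / 2.
  have S1 : 0 < S + 1 by rewrite ltr_wpDl.
  rewrite /d mulrCA ler_piMr//; first by rewrite divr_ge0// ltW.
  by rewrite ler_pdivrMr// mul1r lerDl.
have /choice[F FP] : forall i, exists p : set K * Cspace K R, [/\ VV i p.1,
    uball R p.1 p.2 & weighted_mass i phi - d <= weight R i * phi p.2].
  move=> i; have d20 : 0 < d / 2 by rewrite divr_gt0.
  have [_ [U VU <-] Uvar] : exists2 v : R, [set mass phi U | U in VV i] v &
      family_mass (VV i) phi - d / 2 < v.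
    apply: sup_adherent => //; split; first by have [U VU] := VV_neq0 i; exists (mass phi U), U.
    by exists (mass phi setT) => _ [V _ <-]; exact: mass_mono.
  have [_ [f fU <-] fvarf] : exists2 v : R, [set (phi f : R) | f in uball R U] v &
      mass phi U - d / 2 < v.
    apply: sup_adherent => //; split; first by exists (phi 0), 0 => //; exact: uball0.
    exact: has_ub_mass.
  exists (U, f); split=> //=; rewrite /weighted_mass.
  have : weight R i <= 1 by rewrite exprn_ile1// ?invr_ge0// invf_le1// ler1n.
  have := weight_gt0 R i; nra.
pose g : Cspace K R := \sum_(i < l) (weighted_mass i phi * weight R i) *: (F i).2.
have phig : \sum_(i < l) weighted_mass i phi ^+ 2 - S * d <= phi g.
  rewrite lin_sum// /S mulr_suml -sumrB; apply: ler_sum => i _.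
  rewrite linZ// -mulrA expr2 -mulrBr ler_wpM2l ?weighted_mass_ge0//.
  by case: (FP i).
have Ng : 2 * renorm g <= \sum_(i < l) weighted_mass i phi ^+ 2 + 1.
  rewrite mulrC -ler_pdivlMr//; apply: renorm_le => s [s0 [r [rs r1]]].
  rewrite ler_pdivlMr// mulrC.
  apply: (@le_trans _ _ (\sum_(i < l) (weighted_mass i phi ^+ 2 + r i ^+ 2))); last first.
    by rewrite big_split lerD2l.
  apply: (@le_trans _ _ (2 * \sum_(i < l) weighted_mass i phi * r i)); last first.
    rewrite mulr_sumr; apply: ler_sum => i _.
    rewrite -subr_ge0 (_ : _ - _ = (weighted_mass i phi - r i) ^+ 2) ?sqr_ge0//; ring.
  rewrite ler_pM2l//.
  apply: (@le_trans _ _ (pairing s (fun x => \sum_(i < l)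
      (weighted_mass i phi * weight R i) * \1_((F i).1) x))).
    apply: pairing_le => // x; rewrite C_sumE; apply: le_trans (ler_norm_sum _ _ _) _.
    apply: ler_sum => i _; have w0 : 0 <= weighted_mass i phi * weight R i.
      by rewrite mulr_ge0 ?weighted_mass_ge0 ?weight_ge0.
    rewrite C_scaleE normrM (ger0_norm w0) ler_wpM2l//.
    by case: (FP i) => _ + _; apply.
  rewrite pairing_sum; apply: ler_sum => i _; rewrite pairingZ -mulrA.
  by rewrite ler_wpM2l ?weighted_mass_ge0//; apply: rs; case: (FP i).
have := phiN g; have := ler_norm (phi g : R); lra.
Qed.

Hypothesis Kclopen : forall (x : K) (U : set K), nbhs x U ->
  exists V, [/\ clopen V, V x & V `<=` U].
Hypothesis Khaus : hausdorff_space K.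
Hypothesis Kscat : forall A : set K, A !=set0 -> isolated A !=set0.
Hypothesis VV_open : forall i U, VV i U -> open U.

(** The point masses of phi on a large finite set, divided by rho, form an
    admissible measure, and they almost compute phi f. *)
Lemma sum_weighted_mass_le phi (rho : R) : sup_bounded phi -> 0 < rho ->
  (forall l, \sum_(i < l) weighted_mass i phi ^+ 2 <= rho ^+ 2) ->
  forall f, `|phi f : R| <= rho * renorm f.
Proof.
move=> sphi rho0 phirho f.
have [M M0 fM] := C_bounded f Kcompact.
apply/ler_addgt0Pr => e e0.
have eM0 : 0 < e / M by rewrite divr_gt0.
have [F uF FP] := functional_atomic Kclopen Kcompact Kscat sphi eM0.
have fT : uball R setT (M^-1 *: f).
  move=> x; rewrite indic_in// C_scaleE normrM gtr0_norm ?invr_gt0//.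
  by rewrite ler_pdivrMl// mulr1.
have fF : `|(phi f : R) - \sum_(x <- F) mu phi x * f x| <= e.
  have := FP _ fT; rewrite linZ//.
  under eq_bigr do rewrite C_scaleE mulrCA.
  rewrite -mulr_sumr -mulrBr normrM gtr0_norm ?invr_gt0//.
  by rewrite mulrC ler_pM2r ?invr_gt0.
pose s := [seq (x, `|mu phi x| / rho) | x <- F].
have pairE h : pairing s h = rho^-1 * \sum_(x <- F) `|mu phi x| * h x.
  by rewrite /pairing big_map mulr_sumr; apply: eq_bigr => x _ /=; rewrite mulrAC mulrC.
have sa : admissible s.
  split; first by move=> p /mapP[x _ ->]/=; rewrite divr_ge0// ltW.
  exists (fun i => weighted_mass i phi / rho); split=> [i U VU|l]; last first.
    under eq_bigr do rewrite expr_div_n.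
    by rewrite -mulr_suml ler_pdivrMr ?exprn_gt0// mul1r.
  rewrite pairE mulrCA mulrC ler_pM2r ?invr_gt0// ler_pM2l ?weight_gt0//.
  apply: le_trans (mass_le_family_mass sphi VU).
  rewrite (_ : \sum_(x <- F) _ = \sum_(x <- [seq x <- F | `[< U x >]]) `|mu phi x|).
    apply: (sum_mu_le_mass Kclopen) => //; first exact: filter_uniq.
      exact: VV_open VU.
    by move=> x; rewrite mem_filter => /andP[/asboolP].
  rewrite big_filter [RHS]big_mkcond; apply: eq_bigr => x _.
  by case: asboolP => Ux; [rewrite indic_in// mulr1|rewrite indic_out// mulr0].
have := le_renorm f sa; rewrite pairE ler_pdivrMl// => le1.
have : `|\sum_(x <- F) mu phi x * f x| <= \sum_(x <- F) `|mu phi x| * `|f x : R|.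
  apply: le_trans (ler_norm_sum _ _ _) _.
  by apply: ler_sum => x _; rewrite normrM.
move=> le2; rewrite -[phi f](subrK (\sum_(x <- F) mu phi x * f x)).
apply: le_trans (ler_normD _ _) _; rewrite addrC; apply: lerD => //.
exact: le_trans le2 le1.
Qed.

Lemma weighted_mass_eq (phi psi theta : Cspace K R -> R^o) (a : R) :
  dual renorm phi -> dual renorm psi -> dual renorm theta -> 0 < a < 1 ->
  (forall f, (theta f : R) = a * phi f + (1 - a) * psi f) ->
  dual_norm renorm phi <= 1 -> dual_norm renorm psi <= 1 ->
  dual_norm renorm theta = 1 ->
  forall i, weighted_mass i phi = weighted_mass i theta /\
            weighted_mass i psi = weighted_mass i theta.
Proof.
move=> dphi dpsi dtheta a01 thetaE phi1 psi1 theta1.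
have sphi := dual_sup_bounded dphi; have spsi := dual_sup_bounded dpsi.
have stheta := dual_sup_bounded dtheta.
have /andP[a0 a1] := a01.
apply: (sum_sqr_rigid (p := weighted_mass^~ phi) (q := weighted_mass^~ psi) a01).
- by move=> j; exact: weighted_mass_ge0.
- by move=> j; exact: weighted_mass_ge0.
- by move=> j; exact: weighted_mass_ge0.
- move=> j; rewrite /weighted_mass (mulrCA a) (mulrCA (1 - a)) -mulrDr.
  by rewrite ler_wpM2l ?weight_ge0// family_mass_convex.
- by move=> l; apply: sum_weighted_mass_le1 => //; exact: dual_norm_le1.
- by move=> l; apply: sum_weighted_mass_le1 => //; exact: dual_norm_le1.
- move=> rho rho0 sumt; rewrite -theta1; apply: dual_norm_le; first exact: ltW.
  exact: sum_weighted_mass_le.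
Qed.

End norm.

Theorem strictly_convex_dual_renorming (R : realType) (K : topologicalType)
    (pt : K) (UU : nat -> set_system K) :
  compact [set: K] -> hausdorff_space K -> zero_dimensional K ->
  (forall A : set K, A !=set0 -> isolated A !=set0) ->
  (forall n U, UU n U -> open U) ->
  (forall n U, UU n U -> ~ U pt) ->
  (forall n x, x <> pt -> exists2 U, UU n U & U x) ->
  (forall x y, x <> y -> exists m, forall n U, (m <= n)%N ->
    UU n U -> U x -> U y -> False) ->
  exists N : Cspace K R -> R,
    [/\ is_norm N, equivalent_norms N (@sup_norm K R), lattice_norm N &
        strictly_convex (dual N) (dual_norm N)].
Proof.
move=> Kcompact Khaus Kzero Kscat UUopen UUpt UUcov UUsep.
have Kclopen (x : K) (U : set K) : nbhs x U ->
    exists V, [/\ clopen V, V x & V `<=` U].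
  move=> /(zero_dimensional_cvg Khaus Kzero Kcompact)[V [Vx cV] VU].
  by exists V.
(* The index 0 carries the total variation; the unions of k members of UU n are
   enumerated by the other indices. *)
pose VV i : set_system K := if i is j.+1 then
    let p := odflt (0, 0)%N (unpickle j) in unions UU p.1 p.2
  else [set setT].
have VV0 : VV 0%N setT by [].
have VVneq0 i : VV i !=set0.
  by case: i => [|j]; [exists setT|exact: unions_neq0].
have VVopen i U : VV i U -> open U.
  by case: i => [->|j]; [exact: openT|exact: unions_open].
exists (renorm VV); split.
- exact: renorm_norm.
- exact: renorm_equivalent.
- exact: renorm_lattice.
move=> theta dtheta theta1; split; first by split=> //; rewrite theta1.
move=> phi psi a [dphi phi1] [dpsi psi1] a01 thetaE.
have thetaE' (f : Cspace K R) : (theta f : R) = a * phi f + (1 - a) * psi f.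
  by rewrite thetaE.
have sphi := dual_sup_bounded Kcompact VV0 pt dphi.
have spsi := dual_sup_bounded Kcompact VV0 pt dpsi.
have stheta := dual_sup_bounded Kcompact VV0 pt dtheta.
have VE i : family_mass (VV i) phi = family_mass (VV i) theta /\
            family_mass (VV i) psi = family_mass (VV i) theta.
  have [e1 e2] := weighted_mass_eq Kcompact VV0 pt VVneq0 Kclopen Khaus Kscat VVopen
    dphi dpsi dtheta a01 thetaE' phi1 psi1 theta1 i.
  have w0 : weight R i != 0 by rewrite gt_eqF// weight_gt0.
  by split; apply: (mulfI w0).
apply/funext => f; apply: (eq_of_equal_masses Kclopen Khaus Kcompact Kscat UUopen UUpt UUcov UUsep
  sphi spsi stheta a01 thetaE').
- have [] := VE 0%N; rewrite /VV /family_mass.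
  by rewrite !image_set1 !sup1.
- move=> n k; have := VE (pickle (n, k)).+1.
  by rewrite /VV pickleK.
Qed.

(** * The theorem *)

Theorem corollary2p5 (R : realType) :
  [/\ scattered compact_duplicate,
      compact [set: compact_duplicate] /\ hausdorff_space compact_duplicate,
      ~ gruenhage compact_duplicate &
      has_star compact_duplicate] /\
  exists N : Cspace compact_duplicate R -> R,
    [/\ is_norm N,
        equivalent_norms N (@sup_norm compact_duplicate R),
        lattice_norm N &
        strictly_convex (dual N) (dual_norm N)].
Proof.
split.
  split; [exact: compact_duplicate_scattered| |exact: compact_duplicate_not_gruenhage|
    exact: compact_duplicate_star].
  by split; [exact: compact_duplicate_compact|exact: compact_duplicate_hausdorff].
apply: (@strictly_convex_dual_renorming R compact_duplicate None tail_cover).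
- exact: compact_duplicate_compact.
- exact: compact_duplicate_hausdorff.
- exact: compact_duplicate_zero_dimensional.
- exact: compact_duplicate_isolated.
- exact: tail_cover_open.
- exact: tail_cover_notin_infinity.
- exact: tail_cover_covers.
- exact: tail_cover_separates.
Qed.
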